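(* Let $G=\mathrm{PSL}_2(q)=\mathrm{SL}_2(q)$, where $q$ is a power of $2$. Let $A=\{\,2<d\le q+1 : d\mid q+1\,\}$ and $B=\{\,2<d\le q-1 : d\mid q-1\,\}$. Then the Wedderburn decomposition of the rational group algebra $\mathbb{Q}G$ is given by $$\mathbb{Q}G\;\cong\;\mathbb{Q}\;\oplus\;\bigoplus_{d\in A}\mathrm{M}_{q-1}\big(\mathbb{Q}(\zeta_d+\zeta_d^{-1})\big)\;\oplus\;\mathrm{M}_q(\mathbb{Q})\;\oplus\;\bigoplus_{d\in B}\mathrm{M}_{q+1}\big(\mathbb{Q}(\zeta_d+\zeta_d^{-1})\big).$$
   Context: $\mathbb{F}_q$ is the finite field with $q$ elements; $\mathrm{SL}_2(q)$ is the group of $2\times2$ matrices of determinant $1$ over $\mathbb{F}_q$, and $\mathrm{PSL}_2(q)=\mathrm{SL}_2(q)/Z(\mathrm{SL}_2(q))$ (these coincide when $q$ is a power of $2$). For a positive integer $d$, $\zeta_d\in\mathbb{C}$ denotes a primitive $d$-th root of unity. $\mathrm{M}_n(D)$ is the full ring of $n\times n$ matrices over $D$. The sets $A,B$ consist of integers $d$. The isomorphism is of $\mathbb{Q}$-algebras. *)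

(* Defs.v *)
From HB Require Import structures.
From mathcomp Require Import all_boot all_order all_algebra all_fingroup all_solvable all_field.

Set Implicit Arguments.
Unset Strict Implicit.
Unset Printing Implicit Defensive.

Import GroupScope GRing.Theory.
Local Open Scope ring_scope.

(* The direct product, over i : I, of the full matrix algebras 'M[K i]_n, as an
   algebra over R (rather than over the K i): R acts entrywise through its action
   on each K i. There is no algType instance because I may be empty and n may be
   0, in which case 1 = 0. *)
Definition matrix_prod (R : comNzRingType) (I : finType) (K : I -> algType R)
    (n : nat) : Type :=
  {dffun forall i : I, 'M[K i]_n}.

Section MatrixProd.
Variables (R : comNzRingType) (I : finType) (K : I -> algType R) (n : nat).
Local Notation P := (matrix_prod K n).
Implicit Types (u v w : P) (a b : R).

HB.instance Definition _ := Choice.copy P {dffun forall i : I, 'M[K i]_n}.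

Definition matrix_prod_zero : P := [ffun i => 0 : 'M[K i]_n].
Definition matrix_prod_opp u : P := [ffun i => - u i : 'M[K i]_n].
Definition matrix_prod_add u v : P := [ffun i => u i + v i : 'M[K i]_n].
Definition matrix_prod_one : P := [ffun i => 1%:M : 'M[K i]_n].
Definition matrix_prod_mul u v : P := [ffun i => u i *m v i : 'M[K i]_n].
Definition matrix_prod_scale a u : P :=
  [ffun i => map_mx ( *:%R a) (u i) : 'M[K i]_n].

Fact matrix_prod_addA : associative matrix_prod_add.
Proof. by move=> u v w; apply/ffunP=> i; rewrite !ffunE addrA. Qed.
Fact matrix_prod_addC : commutative matrix_prod_add.
Proof. by move=> u v; apply/ffunP=> i; rewrite !ffunE addrC. Qed.
Fact matrix_prod_add0 : left_id matrix_prod_zero matrix_prod_add.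
Proof. by move=> u; apply/ffunP=> i; rewrite !ffunE add0r. Qed.
Fact matrix_prod_addN :
  left_inverse matrix_prod_zero matrix_prod_opp matrix_prod_add.
Proof. by move=> u; apply/ffunP=> i; rewrite !ffunE addNr. Qed.

HB.instance Definition _ := GRing.isZmodule.Build P
  matrix_prod_addA matrix_prod_addC matrix_prod_add0 matrix_prod_addN.

Fact matrix_prod_mulA : associative matrix_prod_mul.
Proof. by move=> u v w; apply/ffunP=> i; rewrite !ffunE mulmxA. Qed.
Fact matrix_prod_mul1l : left_id matrix_prod_one matrix_prod_mul.
Proof. by move=> u; apply/ffunP=> i; rewrite !ffunE mul1mx. Qed.
Fact matrix_prod_mul1r : right_id matrix_prod_one matrix_prod_mul.
Proof. by move=> u; apply/ffunP=> i; rewrite !ffunE mulmx1. Qed.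
Fact matrix_prod_mulDl : left_distributive matrix_prod_mul +%R.
Proof. by move=> u v w; apply/ffunP=> i; rewrite !ffunE mulmxDl. Qed.
Fact matrix_prod_mulDr : right_distributive matrix_prod_mul +%R.
Proof. by move=> u v w; apply/ffunP=> i; rewrite !ffunE mulmxDr. Qed.

HB.instance Definition _ := GRing.Zmodule_isPzRing.Build P
  matrix_prod_mulA matrix_prod_mul1l matrix_prod_mul1r
  matrix_prod_mulDl matrix_prod_mulDr.

Fact matrix_prod_scaleA a b u :
  matrix_prod_scale a (matrix_prod_scale b u) = matrix_prod_scale (a * b) u.
Proof. by apply/ffunP=> i; apply/matrixP=> j k; rewrite !ffunE !mxE scalerA. Qed.
Fact matrix_prod_scale1 : left_id 1 matrix_prod_scale.
Proof. by move=> u; apply/ffunP=> i; apply/matrixP=> j k; rewrite !ffunE !mxE scale1r. Qed.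
Fact matrix_prod_scaleDr : right_distributive matrix_prod_scale +%R.
Proof. by move=> a u v; apply/ffunP=> i; apply/matrixP=> j k; rewrite !(ffunE, mxE) scalerDr. Qed.
Fact matrix_prod_scaleDl u : {morph matrix_prod_scale^~ u : a b / a + b}.
Proof. by move=> a b; apply/ffunP=> i; apply/matrixP=> j k; rewrite !(ffunE, mxE) scalerDl. Qed.

HB.instance Definition _ := GRing.Zmodule_isLmodule.Build R P
  matrix_prod_scaleA matrix_prod_scale1 matrix_prod_scaleDr matrix_prod_scaleDl.
End MatrixProd.

(* A function f stands for the formal sum of the f x * x, x in G; the product is
   convolution, not the pointwise product that {ffun _ -> R} carries. *)
Definition group_alg (R : comNzRingType) (gT : finGroupType) (G : {group gT}) : Type :=
  {ffun subg_of G -> R}.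

Section GroupAlgebra.
Variables (R : comNzRingType) (gT : finGroupType) (G : {group gT}).
Local Notation RG := (group_alg R G).
Implicit Types (f g h : RG) (x y : subg_of G) (a : R).

HB.instance Definition _ := GRing.Lmodule.copy RG {ffun subg_of G -> R^o}.

Definition group_alg_one : RG := [ffun x => (x == 1%g)%:R].
Definition group_alg_mul f g : RG :=
  [ffun x => \sum_y f y * g (y^-1 * x)%g].

Fact group_alg_mulA : associative group_alg_mul.
Proof.
move=> f g h; apply/ffunP=> x; rewrite !ffunE.
under eq_bigr => y _ do rewrite ffunE big_distrr /=.
under [RHS]eq_bigr => z _ do rewrite ffunE big_distrl /=.
rewrite [RHS]exchange_big /=; apply: eq_bigr => y _.
rewrite [RHS](reindex_inj (mulgI y)) /=; apply: eq_bigr => z _.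
by rewrite mulrA mulKg invMg mulgA.
Qed.
Fact group_alg_mul1l : left_id group_alg_one group_alg_mul.
Proof.
move=> f; apply/ffunP=> x; rewrite ffunE (bigD1 1%g) //= big1 => [|y /negPf ny].
  by rewrite ffunE eqxx mul1r invg1 mul1g addr0.
by rewrite ffunE ny mul0r.
Qed.
Fact group_alg_mul1r : right_id group_alg_one group_alg_mul.
Proof.
move=> f; apply/ffunP=> x; rewrite ffunE (bigD1 x) //= big1 => [|y ny].
  by rewrite ffunE mulVg eqxx mulr1 addr0.
by rewrite ffunE -eq_mulVg1 (negPf ny) mulr0.
Qed.
Fact group_alg_mulDl : left_distributive group_alg_mul +%R.
Proof.
move=> f g h; apply/ffunP=> x; rewrite !ffunE -big_split /=.
by apply: eq_bigr => y _; rewrite !ffunE mulrDl.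
Qed.
Fact group_alg_mulDr : right_distributive group_alg_mul +%R.
Proof.
move=> f g h; apply/ffunP=> x; rewrite !ffunE -big_split /=.
by apply: eq_bigr => y _; rewrite !ffunE mulrDr.
Qed.

Fact group_alg_one_neq0 : group_alg_one != 0.
Proof.
apply/eqP=> /ffunP/(_ 1%g); rewrite !ffunE eqxx => /eqP.
by rewrite oner_eq0.
Qed.

HB.instance Definition _ := GRing.Zmodule_isNzRing.Build RG
  group_alg_mulA group_alg_mul1l group_alg_mul1r group_alg_mulDl group_alg_mulDr
  group_alg_one_neq0.

Fact group_alg_scalerAl a f g : a *: (f * g) = (a *: f) * g.
Proof.
apply/ffunP=> x; rewrite !ffunE scaler_sumr.
by apply: eq_bigr => y _; rewrite !ffunE /GRing.scale /= mulrA.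
Qed.
Fact group_alg_scalerAr a f g : a *: (f * g) = f * (a *: g).
Proof.
apply/ffunP=> x; rewrite !ffunE scaler_sumr.
by apply: eq_bigr => y _; rewrite !ffunE /GRing.scale /= mulrCA.
Qed.

HB.instance Definition _ := GRing.Lmodule_isLalgebra.Build R RG
  group_alg_scalerAl.
HB.instance Definition _ := GRing.Lalgebra_isAlgebra.Build R RG
  group_alg_scalerAr.
End GroupAlgebra.

Section SpecialLinear.
Variable F : finFieldType.

Definition SL2 : {set {'GL_2[F]}} := [set u | \det (GLval u) == 1].

Fact SL2_group_set : group_set SL2.
Proof.
apply/group_setP; split=> [|u v]; rewrite !inE; first by rewrite GL_1E det1.
by rewrite GL_MxE det_mulmx => /eqP-> /eqP->; rewrite mulr1.
Qed.
Canonical SL2_group := Group SL2_group_set.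

Definition PSL2 : {group coset_of 'Z(SL2)} := (SL2 / 'Z(SL2))%G.
End SpecialLinear.

(* Q(z) for an algebraic number z. The last argument of subFExtend only has to be
   some nonzero rational polynomial vanishing at z. *)
Definition Qadjoin (z : algC) : Type :=
  subFExtend (ratr : rat -> algC) z (s2val (minCpolyP z)).

HB.instance Definition _ (z : algC) := GRing.Field.on (Qadjoin z).
HB.instance Definition _ (z : algC) := GRing.Algebra.on (Qadjoin z).

Definition divisors_gt2 (m : nat) : {set 'I_m.+1} :=
  [set d : 'I_m.+1 | (2 < d <= m)%N && (d %| m)%N].

(* Main.v *)
From HB Require Import structures.
Require Import Defs.
From mathcomp Require Import all_boot all_order all_algebra all_fingroup all_solvable all_field.
From mathcomp Require Import all_character.
From mathcomp Require Import ring zify.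

(* Let U be the unipotent subgroup of G = SL_2(q), psi a nontrivial linear
   character of U, and Gam = Ind psi. Since q is even, psi takes values 1 and -1,
   so Gam is rational. Let T and S be the split and nonsplit tori, cyclic of
   orders q - 1 and q + 1. For linear characters la of T and mu of S other than
   1, the virtual characters Ind la - Gam and Gam - Ind mu have norm 1 and
   degrees q + 1 and q - 1, and Ind 1_T - Gam - 1 (the Steinberg character) has
   norm 1 and degree q. So they are irreducible, and each contains psi with
   multiplicity one. As psi is rational, this multiplicity one lets each of them
   be realised over its field of values, a subfield of some
   Q(zeta_d + 1/zeta_d).

   These representations give an algebra morphism from QG to the product. It is
   injective because their Galois conjugates, together with 1, span the regular
   character: the sums of Ind la over all la and of Ind mu over all mu are both
   regular, and Ind 1_T + Ind 1_S = 2 Gam + 2. It is surjective because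
   Q(zeta_d + 1/zeta_d) has degree at most phi(d) / 2, so that the product has
   dimension at most |G|. *)

Set Implicit Arguments.
Unset Strict Implicit.
Unset Printing Implicit Defensive.

Import GroupScope Order.TTheory GRing.Theory Num.Theory.
Local Open Scope ring_scope.

(** * Realising a character over its field of values *)

(** In a full-rank factorisation [E] = X Y, idempotence cancels to Y X = 1, whose trace is the rank;
    characteristic 0 then gives rank 1. *)
Lemma idempotent_trace1 (F : numFieldType) n (E : 'M[F]_n) :
    E *m E = E -> \tr E = 1 ->
  exists X : 'cV_n, exists Y : 'rV_n, E = X *m Y /\ Y *m X = 1%:M.
Proof.
move=> EE trE.
suff: \rank E = 1%N.
  move=> rE; move: (mulmx_base E) (col_base_full E) (row_base_free E).
  move: (col_base E) (row_base E); rewrite rE => X Y XYE Xfull Yfree.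
  exists X, Y; split=> //; apply: (row_full_inj Xfull); rewrite mulmx1.
  apply: (row_free_inj Yfree); by rewrite -mulmxA -(mulmxA Y) mulmxA XYE.
have trXY : \tr (col_base E *m row_base E) = 1 by rewrite mulmx_base.
have XYXY : (col_base E *m row_base E) *m (col_base E *m row_base E) =
    col_base E *m row_base E by rewrite mulmx_base.
move: (col_base_full E) (row_base_free E) trXY XYXY.
move: (col_base E) (row_base E) => X Y Xfull Yfree.
rewrite [X in X = 1]mxtrace_mulC => trXY XYXY.
have YX : Y *m X = 1%:M.
  apply: (row_full_inj Xfull); apply: (row_free_inj Yfree).
  by rewrite mulmx1 -mulmxA -(mulmxA Y) mulmxA.
by move: trXY; rewrite YX mxtrace1 => /eqP; rewrite pnatr_eq1 => /eqP.
Qed.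

Section Realisation.
Variables (gT : finGroupType) (G U : {group gT}) (psi : 'CF(U)).
Variables (L : fieldType) (iota : {rmorphism L -> algC}).
Hypotheses (sUG : U \subset G) (psi_lin : psi \is a linear_char).
Hypothesis psiL : forall u, u \in U -> exists x, psi u = iota x.

(* The projector E onto the psi-eigenspace has rank one, E = X Y. Relative to a
   basis of rows Y rG(c_i) and a basis of columns rG(d_j) X, the matrix of g has
   entries Y rG(c_i g d_j) X = tr (rG(c_i g d_j) E), which lie in L. *)
Lemma repr_realisation n (rG : mx_representation algC G n) :
    mx_irreducible rG -> '['Res[U] (cfRepr rG), psi] = 1 ->
    (forall g, g \in G -> exists x, cfRepr rG g = iota x) ->
  exists rho : gT -> 'M[L]_n,
    [/\ rho 1%g = 1%:M, {in G &, {morph rho : x y / (x * y)%g >-> x *m y}}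
      & {in G, forall g, iota (\tr (rho g)) = cfRepr rG g}].
Proof.
move=> irrG mult1 chiL.
have [cL cLE] : exists cL : gT -> L, forall g, g \in G -> cfRepr rG g = iota (cL g).
  apply: (fin_all_exists (P := fun g x => g \in G -> cfRepr rG g = iota x)) => g.
  have [/chiL[x ->]|_] := boolP (g \in G).
    by exists x.
  by exists 0.
have [pL pLE] : exists pL : gT -> L, forall u, u \in U -> psi u = iota (pL u).
  apply: (fin_all_exists (P := fun u x => u \in U -> psi u = iota x)) => g.
  have [/psiL[x ->]|_] := boolP (g \in U).
    by exists x.
  by exists 0.
have inG u : u \in U -> u \in G by apply: (subsetP sUG).
pose E := #|U|%:R^-1 *: \sum_(u in U) psi u^-1%g *: rG u.
have U_neq0 : #|U|%:R != 0 :> algC by rewrite pnatr_eq0 -lt0n cardG_gt0.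
have uE u : u \in U -> rG u *m E = psi u *: E.
  move=> Uu; rewrite /E -scalemxAr [RHS]scalerA [psi u * _]mulrC -scalerA; congr (_ *: _).
  rewrite mulmx_sumr scaler_sumr [RHS](reindex_inj (mulgI u)) /=.
  apply: eq_big => [v|v Uv]; first by rewrite groupMl.
  rewrite -scalemxAr repr_mxM ?inG // invMg scalerA lin_charM ?groupV //.
  by rewrite mulrCA -lin_charM ?groupV // mulgV lin_char1 // mulr1.
have EE : E *m E = E.
  rewrite {1}/E -scalemxAl mulmx_suml.
  rewrite (eq_bigr (fun=> E)) => [|u Uu].
    by rewrite sumr_const -scaler_nat scalerA mulVf ?scale1r.
  by rewrite -scalemxAl uE // scalerA -lin_charM ?groupV // mulVg lin_char1 // scale1r.
have trE g : g \in G ->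
    \tr (rG g *m E) = #|U|%:R^-1 * \sum_(u in U) psi u^-1%g * cfRepr rG (g * u)%g.
  move=> Gg; rewrite -scalemxAr mxtraceZ mulmx_sumr raddf_sum /=; congr (_ * _).
  apply: eq_bigr => u Uu; have Gu := inG u Uu.
  by rewrite -scalemxAr mxtraceZ -repr_mxM // cfunE groupM.
have trE1 : \tr E = 1.
  have := trE 1%g (group1 G); rewrite repr_mx1 mul1mx => ->; rewrite -[RHS]mult1 cfdotE.
  congr (_ * _); apply: eq_bigr => u Uu.
  by rewrite mul1g cfResE // lin_charV_conj // mulrC.
have [X [Y [EXY YX]]] := idempotent_trace1 EE trE1.
have [n_gt0 irrP] := (mx_irrP rG).1 irrG.
pose R := \matrix_(k < #|G|) (Y *m rG (enum_val k)).
pose C := \matrix_(k < #|G|) (rG (enum_val k) *m X)^T.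
(* The rows Y rG(g) span a submodule, nonzero because Y is, hence everything by irreducibility. *)
have Rfull : row_full R.
  suff: row_full <<R>>%MS by rewrite /row_full genmxE.
  apply: irrP.
    apply/mxmoduleP=> x Gx; rewrite (eqmxMr _ (genmxE R)) genmxE.
    apply/row_subP=> k; rewrite row_mul rowK -mulmxA -repr_mxM ?enum_valP //.
    have Gkx : (enum_val k * x)%g \in G by rewrite groupM ?enum_valP.
    have := row_sub (enum_rank_in Gkx (enum_val k * x)%g) R.
    by rewrite rowK enum_rankK_in.
  apply: contraTneq isT => /eqP; rewrite -mxrank_eq0 genmxE mxrank_eq0 => /eqP R0.
  have := row_sub (enum_rank_in (group1 G) 1%g) R.
  rewrite rowK enum_rankK_in // repr_mx1 mulmx1 R0 => /submx0null Y0.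
  move: YX; rewrite Y0 mul0mx => /matrixP/(_ 0 0); rewrite !mxE /= => /eqP.
  by rewrite eq_sym oner_eq0.
(* Dually, the row vectors killing all columns rG(h) X form a submodule, and a proper one because X
   is nonzero. *)
have Cfull : row_full C.
  have CT0 m (W : 'M_(m, n)) :
      reflect (forall h, h \in G -> W *m (rG h *m X) = 0) (W <= kermx C^T)%MS.
    apply: (iffP sub_kermxP) => [WC h Gh|WC].
      have := congr1 (col (enum_rank_in Gh h)) WC.
      by rewrite !colE -mulmxA mul0mx -colE -tr_row rowK enum_rankK_in // trmxK.
    apply/trmx_inj; rewrite trmx_mul trmxK trmx0; apply/row_matrixP=> k.
    by rewrite row_mul rowK row0 -trmx_mul WC ?trmx0 ?enum_valP.
  suff: kermx C^T == 0 by rewrite kermx_eq0 -row_leq_rank mxrank_tr col_leq_rank.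
  apply/negPn/negP => /irrP kerfull.
  suff /kerfull : mxmodule rG (kermx C^T).
    rewrite -sub1mx => /CT0/(_ _ (group1 G)); rewrite mul1mx repr_mx1 mul1mx => X0.
    move: YX; rewrite X0 mulmx0 => /matrixP/(_ 0 0); rewrite !mxE /= => /eqP.
    by rewrite eq_sym oner_eq0.
  apply/mxmoduleP=> x Gx; apply/CT0 => h Gh.
  rewrite -mulmxA (mulmxA (rG x)) -repr_mxM //.
  by move/CT0: (submx_refl (kermx C^T)); apply; rewrite groupM.
pose P := rowsub (fullrankfun Rfull) R; pose Q := (rowsub (fullrankfun Cfull) C)^T.
have Punit : P \in unitmx by apply: fullrowsub_unit.
have Qunit : Q \in unitmx by rewrite unitmx_tr; apply: fullrowsub_unit.
pose c k := enum_val (fullrankfun Rfull k); pose d k := enum_val (fullrankfun Cfull k).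
have Gc k : c k \in G by apply: enum_valP.
have Gd k : d k \in G by apply: enum_valP.
pose N g : 'M[L]_n := \matrix_(i, j)
  (#|U|%:R^-1 * \sum_(u in U) pL u^-1%g * cL (c i * g * d j * u)%g).
have NE g : g \in G -> map_mx iota (N g) = P *m rG g *m Q.
  move=> Gg; apply/matrixP=> i j; transitivity (iota (N g i j)); first by rewrite mxE.
  rewrite [N g i j]mxE rmorphM fmorphV rmorph_nat rmorph_sum /=.
  transitivity (\tr (rG (c i * g * d j)%g *m E)).
    rewrite trE ?groupM //; congr (_ * _); apply: eq_bigr => u Uu.
    have Gu := inG u Uu.
    by rewrite rmorphM -pLE ?groupV // -cLE ?groupM ?Gc ?Gd.
  have rowP : row i P = Y *m rG (c i) by rewrite row_rowsub rowK.
  have colQ : col j Q = rG (d j) *m X.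
    by rewrite -tr_row row_rowsub rowK trmxK.
  have -> : (P *m rG g *m Q) i j = (row i P *m rG g *m col j Q) 0 0.
    by rewrite -row_mul !mxE; apply: eq_bigr => k _; rewrite !mxE.
  rewrite rowP colQ EXY mulmxA mxtrace_mulC -trace_mx11 !repr_mxM ?groupM ?Gc ?Gd //.
  by rewrite !mulmxA.
have Nunit : N 1%g \in unitmx.
  rewrite -(map_unitmx iota) NE // repr_mx1 mulmx1 unitmx_mul Punit.
  exact: Qunit.
(* As [N g] = P rG(g) Q, dividing by [N 1%g] = P Q leaves P rG(g) P^-1, a conjugate of rG that is
   now defined over L. *)
pose rho g := N g *m invmx (N 1%g).
have rhoE g : g \in G -> map_mx iota (rho g) = P *m rG g *m invmx P.
  move=> Gg; rewrite map_mxM map_invmx !NE // repr_mx1 mulmx1.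
  have PQunit : P *m Q \in unitmx by rewrite unitmx_mul Punit.
  by apply: (canLR (mulmxK PQunit)); rewrite mulmxA mulmxKV.
exists rho; split=> [|g h Gg Gh|g Gg]; first by rewrite /rho mulmxV.
  apply: (map_mx_inj (f := iota)); rewrite map_mxM !rhoE ?groupM //.
  by rewrite repr_mxM // !mulmxA mulmxKV.
rewrite -trace_map_mx rhoE // mxtrace_mulC mulmxA mulVmx // mul1mx.
by rewrite cfunE Gg.
Qed.

Lemma irr_realisation n (i : Iirr G) :
    'chi_i 1%g = n%:R -> '['Res[U] 'chi_i, psi] = 1 ->
    (forall g, g \in G -> exists x, 'chi_i g = iota x) ->
  exists rho : gT -> 'M[L]_n,
    [/\ rho 1%g = 1%:M, {in G &, {morph rho : x y / (x * y)%g >-> x *m y}}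
      & {in G, forall g, iota (\tr (rho g)) = 'chi_i g}].
Proof.
rewrite irr1_degree => /eqP; rewrite eqr_nat => /eqP <-.
rewrite -irrRepr; apply: repr_realisation; exact: socle_irr.
Qed.
End Realisation.

(** * Induced class functions *)

Section InducedValues.
Variables (gT : finGroupType) (G : {group gT}).
Implicit Types (H T : {group gT}) (x y t : gT).

(** Sorting the terms of the induction formula by the value of [x ^ y] leaves only counts of
    conjugating elements, the form in which the fusion of U and of the tori is given later. *)
Lemma cfInd_count H (phi : 'CF(H)) x : H \subset G ->
  'Ind[G] phi x =
    #|H|%:R^-1 * \sum_(t in H) #|[set y in G | (x ^ y)%g == t]|%:R * phi t.
Proof.
move=> sHG; rewrite cfIndE //; congr (_ * _).
rewrite (bigID (fun y => (x ^ y)%g \in H)) /= addrC big1 ?add0r => [|y /andP[_ nHy]].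
  rewrite (partition_big (fun y => (x ^ y)%g) (mem H)) /= => [|y /andP[]//].
  apply: eq_bigr => t Ht; rewrite mulr_natl -sumr_const.
  apply: eq_big => [y|y /andP[_ /eqP->]//]; rewrite inE.
  by case: eqP => [->|]; rewrite ?Ht ?andbT ?andbF.
by rewrite cfun0.
Qed.

Lemma cfInd_coprime_eq0 H (phi : 'CF(H)) x :
  H \subset G -> coprime #[x] #|H| -> x != 1%g -> 'Ind[G] phi x = 0.
Proof.
move=> sHG co_xH ntx; rewrite cfIndE // big1 ?mulr0 // => y _.
apply: cfun0; apply: contra ntx => Hxy; rewrite -order_eq1 -dvdn1.
by rewrite -(eqP co_xH) dvdn_gcd dvdnn -(orderJ x y) order_dvdG.
Qed.

(** By Frobenius reciprocity the product is taken on H, where only the term at 1 survives. *)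
Lemma cfdot_Ind_vanish H (phi : 'CF(G)) (theta : 'CF(H)) :
    H \subset G -> {in H^#, forall t, phi t = 0} ->
  '[phi, 'Ind[G] theta] = #|H|%:R^-1 * (phi 1%g * (theta 1%g)^*).
Proof.
move=> sHG phi0; rewrite -cfdot_Res_l cfdotE; congr (_ * _).
rewrite (bigD1 1%g) //= big1 => [|t /andP[Ht nt]].
  by rewrite addr0 cfRes1.
by rewrite cfResE // phi0 ?mul0r // !inE nt.
Qed.

Lemma cfZRegE H (c : algC) x :
  (c *: cfReg H) x = c * (#|H|%:R *+ (x == 1%g)).
Proof. by rewrite -cfRegE cfunE. Qed.

Lemma cfdot_Reg H (phi : 'CF(H)) : '[cfReg H, phi] = (phi 1%g)^*.
Proof.
rewrite cfdotE (bigD1 1%g) //= big1 => [|t /andP[_ /negPf nt]].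
  by rewrite addr0 cfRegE eqxx mulKf // pnatr_eq0 -lt0n cardG_gt0.
by rewrite cfRegE nt mul0r.
Qed.

Lemma cfdot_lin H (la mu : 'CF(H)) :
  la \is a linear_char -> mu \is a linear_char -> '[la, mu] = (la == mu)%:R.
Proof.
move=> /lin_char_irr/irrP[i ->] /lin_char_irr/irrP[j ->].
by rewrite cfdot_irr (inj_eq irr_inj).
Qed.

(** A real linear character takes values of square 1, and odd order makes them 1. *)
Lemma odd_conj_lin_neq T (la : 'CF(T)) :
  odd #|T| -> la \is a linear_char -> la != 1 -> (la^*)%CF != la.
Proof.
move=> oddT lin_la; apply: contra => /eqP laC; apply/eqP/cfun_inP=> t Tt.
rewrite cfun1E Tt.
have la2 : la t ^+ 2 = 1.
  by rewrite expr2 -{1}laC cfConjCE -lin_charV_conj // -lin_charM ?groupV // mulVg lin_char1.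
have : la t ^+ #|T| = 1 by rewrite -lin_charX // expg_cardG ?lin_char1.
by rewrite -[#|T|]odd_double_half oddT -mul2n exprD exprM la2 expr1n mulr1.
Qed.

Lemma vchar_norm1_irr (phi : 'CF(G)) :
  phi \in 'Z[irr G] -> '[phi] = 1 -> 0 < phi 1%g -> phi \in irr G.
Proof.
move=> /vchar_norm1P phiP /phiP[b [i ->]] {phiP}.
case: b; last by rewrite scale1r mem_irr.
by rewrite scaleN1r cfunE oppr_gt0 lt_gtF ?irr1_gt0.
Qed.

End InducedValues.

(** * Coordinates and dimension *)

Section Coordinates.

(* dim V <= #|J|; the factors of the product carry no vectType structure. *)
Definition embeds_in (V : lmodType rat) (J : finType) :=
  exists c : V -> J -> rat,
    (forall r u v j, c (r *: u + v) j = r * c u j + c v j)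
    /\ (forall u, (forall j, c u j = 0) -> u = 0).

Lemma embeds_rat : embeds_in rat^o unit.
Proof. by exists (fun x _ => x); split=> // u /(_ tt). Qed.

Lemma embeds_pair (V1 V2 : lmodType rat) J1 J2 :
  embeds_in V1 J1 -> embeds_in V2 J2 -> embeds_in (V1 * V2)%type (J1 + J2)%type.
Proof.
move=> [c1 [c1L c1I]] [c2 [c2L c2I]].
exists (fun v j => match j with inl j => c1 v.1 j | inr j => c2 v.2 j end).
split=> [r u v [] j|[u1 u2] u0]; [exact: c1L | exact: c2L|].
congr (_, _); first by apply: c1I => j; have := u0 (inl j).
by apply: c2I => j; have := u0 (inr j).
Qed.

Lemma embeds_matrix n : embeds_in 'M[rat]_n ('I_n * 'I_n)%type.
Proof.
exists (fun (M : 'M[rat]_n) ij => M ij.1 ij.2); split=> [r u v j|u u0]; first by rewrite !mxE.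
by apply/matrixP=> i j; rewrite mxE (u0 (i, j)).
Qed.

Lemma embeds_matrix_prod (I : finType) (K : I -> algType rat) (J : I -> finType) n :
    (forall i, embeds_in (K i) (J i)) ->
  embeds_in (matrix_prod K n) {i : I & ('I_n * 'I_n * J i)%type}.
Proof.
case/fin_all_exists=> c cP.
exists (fun (u : matrix_prod K n) (ijk : {i : I & ('I_n * 'I_n * J i)%type}) =>
  c (tag ijk) (u (tag ijk) (tagged ijk).1.1 (tagged ijk).1.2) (tagged ijk).2).
split=> [r u v [i [[j l] k]] | u u0] /=.
  by rewrite ffunE ffunE !mxE (cP i).1.
apply/ffunP=> i; rewrite ffunE; apply/matrixP=> j l; rewrite mxE.
by apply: (cP i).2 => k; have := u0 (Tagged _ (j, l, k)).
Qed.

Lemma linear_inj_surj m n (f : {linear 'rV[rat]_m -> 'rV[rat]_n}) :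
  (n <= m)%N -> (forall v, f v = 0 -> v = 0) -> forall w, exists v, f v = w.
Proof.
move=> le_nm f_inj w.
have ff : row_free (lin1_mx f) by apply: inj_row_free => v; rewrite mul_rV_lin1; exact: f_inj.
have : row_full (lin1_mx f).
  by rewrite -col_leq_rank (eqP ff).
by case/row_fullP=> A Af; exists (w *m A); rewrite -mul_rV_lin1 -mulmxA Af mulmx1.
Qed.

(** In coordinates, f becomes an injective linear map from Q^|G| to Q^|J|; as |J| is at most |G|, it
    is onto. *)
Lemma group_alg_inj_bij (gT : finGroupType) (G : {group gT}) (W : lmodType rat)
    (J : finType) (f : group_alg rat G -> W) :
    linear f -> (forall a, f a = 0 -> a = 0) -> embeds_in W J ->
  (#|J| <= #|G|)%N -> bijective f.
Proof.
move=> f_lin f_inj [c [cL cI]] cardJ.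
have f_sub a b : f (a - b) = f a - f b.
  by have := f_lin (-1) b a; rewrite !scaleN1r [- b + a]addrC [- f b + _]addrC.
have inj_f : injective f.
  by move=> a b /eqP; rewrite -subr_eq0 -f_sub => /eqP/f_inj/eqP; rewrite subr_eq0 => /eqP.
pose m := #|{: subg_of G}|.
have cardm : m = #|G| by rewrite /m card_sub; apply: eq_card.
pose comb (v : 'rV[rat]_m) : group_alg rat G := [ffun x => v 0 (enum_rank x)].
have combL r u v : comb (r *: u + v) = r *: comb u + comb v.
  by apply/ffunP=> x; rewrite !ffunE !mxE.
pose h (v : 'rV[rat]_m) : 'rV[rat]_#|J| := \row_j c (f (comb v)) (enum_val j).
have hL : linear h.
  by move=> r u v; apply/rowP=> j; rewrite !mxE combL f_lin cL.
pose hlin : {linear 'rV_m -> 'rV_#|J|} := HB.pack h (GRing.isLinear.Build _ _ _ _ h hL).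
have h_inj v : hlin v = 0 -> v = 0.
  move=> hv; have: comb v = 0.
    apply: f_inj; apply: cI => j; have /rowP/(_ (enum_rank j)) := hv.
    by rewrite !mxE enum_rankK.
  move/ffunP=> v0; apply/rowP=> k; have := v0 (enum_val k).
  by rewrite !ffunE enum_valK mxE.
have f_surj w : exists a, f a == w.
  have [|v hv] := linear_inj_surj _ h_inj (\row_j c w (enum_val j)).
    by rewrite cardm.
  exists (comb v); rewrite -subr_eq0; apply/eqP; apply: cI => j.
  rewrite addrC -scaleN1r cL mulN1r.
  have /rowP/(_ (enum_rank j)) := hv; rewrite !mxE enum_rankK => ->.
  exact: addNr.
exists (fun w => xchoose (f_surj w)) => [a | w]; last exact: (eqP (xchooseP (f_surj w))).
by apply: inj_f; apply/eqP; apply: (xchooseP (f_surj (f a))).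
Qed.
End Coordinates.

(** * The fields Q(w): dimension and embedding in the algebraic numbers *)

Lemma embeds_subfx (L : fieldType) (iota : {rmorphism rat -> L}) z (p : {poly rat}) :
    root (map_poly iota p) z -> irreducible_poly p ->
  embeds_in (subFExtend iota z p) 'I_(size p).-1.
Proof.
move=> pz0 irr_p; have [c cL [c' cK _]] := min_subfx_vect pz0 irr_p.
have c0 : c 0 = 0.
  have := cL (-1) 0 0; rewrite scaler0 addr0 scaleN1r addNr; exact: id.
exists (fun u j => c u 0 j); split=> [r u v j | u u0]; first by rewrite cL !mxE.
rewrite -(cK u) -(cK 0) c0; congr (c' _).
by apply/rowP=> j; rewrite u0 mxE.
Qed.

Lemma embeds_Qadjoin w : embeds_in (Qadjoin w) 'I_(size (s2val (minCpolyP w))).-1.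
Proof.
apply: embeds_subfx; case: (minCpolyP w) => p [Dp p_mon] p_min /=.
  by rewrite p_min.
have pw0 : root (map_poly ratr p) w by rewrite p_min.
apply/(subfx_irreducibleP pw0 (monic_neq0 p_mon)) => r rw0 nz_r.
by rewrite dvdp_leq // -p_min.
Qed.

Definition Qadjoin_val w (x : Qadjoin w) : algC := subfx_inj x.
HB.instance Definition _ w := GRing.RMorphism.copy (@Qadjoin_val w) subfx_inj.

Lemma Qadjoin_val_root w : exists x : Qadjoin w, w = Qadjoin_val x.
Proof.
exists (subfx_root _ _ _); rewrite /Qadjoin_val subfx_inj_root //.
  by case: (minCpolyP w) => p [Dp p_mon] p_min /=; rewrite p_min.
by case: (minCpolyP w) => p [Dp p_mon] p_min /=; apply: monic_neq0.
Qed.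

(** * Representations of the group algebra *)

Section GroupAlgebraRepresentation.
Variables (gT : finGroupType) (G : {group gT}).
Implicit Types (a b : group_alg rat G).

(** The linear extension of [rho] to the group algebra, written entrywise because rational scalars
    act on the entries, while ['M[K]_n] is a module over K. *)
Definition rep_alg (K : algType rat) n (rho : gT -> 'M[K]_n) a : 'M[K]_n :=
  \matrix_(i, j) \sum_x a x *: rho (val x) i j.

Section Rep.
Variables (K : algType rat) (n : nat) (rho : gT -> 'M[K]_n).
Hypotheses (rho1 : rho 1%g = 1%:M)
  (rhoM : {in G &, {morph rho : x y / (x * y)%g >-> x *m y}}).

Lemma rep_algL r a b i j :
  rep_alg rho (r *: a + b) i j = r *: rep_alg rho a i j + rep_alg rho b i j.
Proof.
rewrite !mxE scaler_sumr -big_split /=; apply: eq_bigr => x _.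
by rewrite !ffunE scalerA -scalerDl.
Qed.

Lemma rep_alg1 : rep_alg rho 1 = 1%:M.
Proof.
apply/matrixP=> i j; rewrite -rho1 /rep_alg mxE (bigD1 1%g) //= big1 => [|x /negPf nx].
  by rewrite ffunE eqxx scale1r addr0.
by rewrite ffunE nx scale0r.
Qed.

Lemma rep_algM a b : rep_alg rho (a * b) = rep_alg rho a *m rep_alg rho b.
Proof.
apply/matrixP=> i j; rewrite !mxE.
transitivity (\sum_x \sum_y (a y * b (y^-1 * x)%g) *: rho (val x) i j).
  by apply: eq_bigr => x _; rewrite ffunE scaler_suml.
rewrite exchange_big /=.
transitivity (\sum_y \sum_x \sum_k (a y *: rho (val y) i k) * (b x *: rho (val x) k j)).
  apply: eq_bigr => y _; rewrite (reindex_inj (mulgI y)) /=; apply: eq_bigr => x _.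
  rewrite mulKg (rhoM (valP y) (valP x)) mxE scaler_sumr;apply: eq_bigr => k _.
  by rewrite -scalerAl -scalerAr scalerA.
transitivity (\sum_y \sum_k \sum_x (a y *: rho (val y) i k) * (b x *: rho (val x) k j)).
  by apply: eq_bigr => y _; rewrite exchange_big.
rewrite exchange_big; apply: eq_bigr => k _ /=.
rewrite !mxE mulr_suml; apply: eq_bigr => y _.
by rewrite mulr_sumr.
Qed.
End Rep.

(* phi, extended linearly to the group algebra, vanishes on the right ideal
   generated by a. *)
Definition annihilates a (phi : 'CF(G)) :=
  forall h, h \in G -> \sum_x ratr (a x) * phi (val x * h)%g = 0.

(** The sum in question is [iota] of the trace of rho(a) rho(h), hence 0 once rho(a) is. *)
Lemma rep_alg_annihilates (K : algType rat) n (rho : gT -> 'M[K]_n)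
    (iota : {rmorphism K -> algC}) (phi : 'CF(G)) a :
    {in G &, {morph rho : x y / (x * y)%g >-> x *m y}} ->
    {in G, forall g, iota (\tr (rho g)) = phi g} ->
  rep_alg rho a = 0 -> annihilates a phi.
Proof.
move=> rhoM rho_tr rho_a h Gh.
(* A ring morphism is Q-linear, since any morphism from [rat] agrees with [ratr]. *)
have iotaZ r x : iota (r *: x) = ratr r * iota x.
  rewrite -[x in LHS]mul1r scalerAl rmorphM; congr (_ * _).
  exact: (fmorph_eq_rat (iota \o in_alg K)).
transitivity (iota (\sum_x a x *: \tr (rho (val x * h)%g))).
  rewrite rmorph_sum; apply: eq_bigr => x _.
  by rewrite /= iotaZ rho_tr // groupM // (valP x).
rewrite -[RHS](rmorph0 iota); congr (iota _).
transitivity (\sum_i \sum_k rep_alg rho a i k * rho h k i); last first.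
  by rewrite big1 // => i _; rewrite big1 // => k _; rewrite rho_a mxE mul0r.
transitivity (\sum_i \sum_x \sum_k (a x *: rho (val x) i k) * rho h k i); last first.
  apply: eq_bigr => i _; rewrite exchange_big; apply: eq_bigr => k _.
  by rewrite mxE mulr_suml.
rewrite exchange_big; apply: eq_bigr => x _.
rewrite (rhoM _ _ (valP x) Gh) scaler_sumr; apply: eq_bigr => i _.
rewrite mxE scaler_sumr; apply: eq_bigr => k _.
by rewrite scalerAl.
Qed.

Section Annihilates.
Variable a : group_alg rat G.

Lemma annihilatesD phi psi :
  annihilates a phi -> annihilates a psi -> annihilates a (phi + psi).
Proof.
move=> aphi apsi h Gh; under eq_bigr => x _ do rewrite cfunE mulrDr.
by rewrite big_split /= aphi // apsi // addr0.
Qed.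

Lemma annihilatesZ c phi : annihilates a phi -> annihilates a (c *: phi).
Proof.
move=> aphi h Gh; under eq_bigr => x _ do rewrite cfunE mulrCA.
by rewrite -mulr_sumr aphi // mulr0.
Qed.

Lemma annihilates_sum (I : finType) (phi : I -> 'CF(G)) :
  (forall i, annihilates a (phi i)) -> annihilates a (\sum_i phi i).
Proof.
move=> aphi; elim/big_ind: _ => [|psi1 psi2|//]; last exact: annihilatesD.
by move=> h Gh; rewrite big1 // => x _; rewrite cfunE mulr0.
Qed.

(** The coefficients of a are rational, so u fixes them; one member of each Galois orbit is thus
    enough. *)
Lemma annihilates_aut (u : {rmorphism algC -> algC}) phi :
  annihilates a phi -> annihilates a (cfAut u phi).
Proof.
move=> aphi h Gh; transitivity (u (\sum_x ratr (a x) * phi (val x * h)%g)).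
  by rewrite rmorph_sum; apply: eq_bigr => x _; rewrite rmorphM /= fmorph_rat cfunE.
by rewrite aphi ?rmorph0.
Qed.

(** Taking h = x^-1 isolates |G| times the coefficient of x. *)
Lemma annihilates_reg : annihilates a (cfReg G) -> a = 0.
Proof.
move=> areg; apply/ffunP=> x; rewrite ffunE.
have := areg (val x)^-1%g (groupVr (valP x)); rewrite (bigD1 x) //= big1 => [|y nyx].
  rewrite cfRegE mulgV eqxx addr0 => /eqP; rewrite mulf_eq0 fmorph_eq0.
  by rewrite pnatr_eq0 -[#|G| == 0%N]negbK -lt0n cardG_gt0 orbF => /eqP.
by rewrite cfRegE -eq_mulgV1 (inj_eq val_inj) (negPf nyx) mulr0.
Qed.
End Annihilates.
End GroupAlgebraRepresentation.

(** * Linear characters and their values *)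

Section FieldImage.
Variables (L : fieldType) (iota : {rmorphism L -> algC}).

Definition in_image x := exists y, x = iota y.

Lemma in_image_nat n : in_image n%:R.
Proof. by exists n%:R; rewrite rmorph_nat. Qed.

Lemma in_imageN x : in_image x -> in_image (- x).
Proof. by case=> y ->; exists (- y); rewrite rmorphN. Qed.

Lemma in_imageV x : in_image x -> in_image x^-1.
Proof. by case=> y ->; exists y^-1; rewrite fmorphV. Qed.

Lemma in_imageD x x' : in_image x -> in_image x' -> in_image (x + x').
Proof. by case=> y -> [y' ->]; exists (y + y'); rewrite rmorphD. Qed.

Lemma in_imageM x x' : in_image x -> in_image x' -> in_image (x * x').
Proof. by case=> y -> [y' ->]; exists (y * y'); rewrite rmorphM. Qed.

Lemma in_image_sum (I : finType) (P : pred I) (E : I -> algC) :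
  (forall i, in_image (E i)) -> in_image (\sum_(i | P i) E i).
Proof.
move=> imE; elim/big_ind: _ => //; first exact: (in_image_nat 0).
exact: in_imageD.
Qed.

(** Chebyshev recurrence, with two consecutive exponents carried through the induction. *)
Lemma in_image_power_trace z i : z != 0 ->
  in_image (z + z^-1) -> in_image (z ^+ i + z ^- i).
Proof.
move=> nz_z imz.
suff [] : in_image (z ^+ i + z ^- i) /\ in_image (z ^+ i.+1 + z ^- i.+1) by [].
elim: i => [|i [im0 im1]].
  by rewrite expr0 expr1 invr1; split=> //; apply: (in_image_nat 2).
split=> //.
have -> : z ^+ i.+2 + z ^- i.+2 =
    (z + z^-1) * (z ^+ i.+1 + z ^- i.+1) + - (z ^+ i + z ^- i).
  rewrite !exprS; field; by rewrite nz_z expf_neq0.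
by apply: in_imageD; [apply: in_imageM | apply: in_imageN].
Qed.
End FieldImage.

Section CyclicLinearCharacters.
Variables (gT : finGroupType) (T : {group gT}) (t : gT).
Hypothesis genT : T :=: <[t]>.

Lemma gen_mem : t \in T. Proof. by rewrite genT cycle_id. Qed.

Lemma cyclic_lin i : 'chi[T]_i \is a linear_char.
Proof. by apply: irr_cyclic_lin; apply/cyclicP; exists t. Qed.

Lemma lin_char_gen_inj (la mu : 'CF(T)) :
  la \is a linear_char -> mu \is a linear_char -> la t = mu t -> la = mu.
Proof.
move=> lin_la lin_mu eq_t; apply/cfun_inP=> x Tx; have /cycleP[i ->] : x \in <[t]> by rewrite -genT.
by rewrite !lin_charX ?gen_mem // eq_t.
Qed.

Lemma lin_char_gen_root (la : 'CF(T)) : la \is a linear_char -> la t ^+ #|T| = 1.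
Proof.
by move=> lin_la; rewrite -lin_charX ?gen_mem // expg_cardG ?gen_mem // lin_char1.
Qed.

Lemma card_Iirr_cyclic : #|Iirr T| = #|T|.
Proof.
rewrite card_ord NirrE; apply/eqP; rewrite -card_classes_abelian.
by rewrite genT cycle_abelian.
Qed.

(** The |T| irreducible characters have distinct values at t, all roots of X^|T| - 1; one more root
    would exceed the degree. *)
Lemma lin_char_of_root xi : xi ^+ #|T| = 1 ->
  exists2 la : 'CF(T), la \is a linear_char & la t = xi.
Proof.
move=> xiT; pose rs := [seq 'chi[T]_i t | i <- enum (Iirr T)].
have rs_uniq : uniq rs.
  rewrite map_inj_uniq ?enum_uniq // => i j /(lin_char_gen_inj (cyclic_lin i) (cyclic_lin j)).
  exact: irr_inj.
have [/mapP[i _ ->] | nrs] := boolP (xi \in rs).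
  by exists 'chi_i => //; apply: cyclic_lin.
have: (size (xi :: rs) <= #|T|)%N.
  apply: max_unity_roots => //; last by rewrite /= nrs.
  apply/allP=> x; rewrite inE => /orP[/eqP-> | /mapP[i _ ->]]; apply/unity_rootP => //.
  exact: lin_char_gen_root (cyclic_lin i).
by rewrite /= size_map -cardE card_Iirr_cyclic ltnn.
Qed.
End CyclicLinearCharacters.

(** U has as many irreducible characters as elements, so a nontrivial one exists; its values on U
    have square 1, and outside U it is 0. *)
Lemma sign_lin_char (gT : finGroupType) (U : {group gT}) :
    abelian U -> (1 < #|U|)%N -> {in U, forall u, u ^+ 2 = 1}%g ->
  exists psi : 'CF(U), [/\ psi \is a linear_char, psi != 1
    & forall u, exists m : int, psi u = m%:~R].
Proof.
move=> abelU U_gt1 U2.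
have [i nz_i] : exists i : Iirr U, i != 0.
  apply/existsP; rewrite -negb_forall; apply: contraL U_gt1 => /forallP i0.
  rewrite -leqNgt -(eqP (_ : #|classes U| == #|U|)) -?card_classes_abelian //.
  rewrite -NirrE -[Nirr U]card_ord -(cards1 (0 : Iirr U)) -cardsT subset_leq_card //.
  by apply/subsetP=> i _; rewrite inE i0.
have lin_psi := char_abelianP _ abelU i.
exists 'chi_i; split=> // [|u]; first by rewrite -irr0 (inj_eq irr_inj).
have [Uu|nUu] := boolP (u \in U); last by exists 0; rewrite cfun0.
have: ('chi_i u) ^+ 2 == 1 by rewrite -lin_charX // U2 ?lin_char1.
by rewrite sqrf_eq1 => /orP[] /eqP->; [exists 1 | exists (-1)].
Qed.

Lemma cfInd_reg (gT : finGroupType) (G T : {group gT}) :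
  T \subset G -> 'Ind[G] (cfReg T) = cfReg G.
Proof.
move=> sTG; apply/cfun_inP=> g Gg; rewrite cfIndE // cfRegE.
under eq_bigr => y _ do rewrite cfRegE conjg_eq1.
by rewrite sumr_const mulrnAC mulrnAr -[_ *+ #|G|]mulr_natr mulKf // pnatr_eq0 -lt0n cardG_gt0.
Qed.

(** * The characters of SL_2(q) from its tori *)

Section GelfandGraev.
Variables (gT : finGroupType) (G U : {group gT}) (psi : 'CF(U)) (q : nat).
Hypotheses (q_gt1 : (1 < q)%N) (sUG : U \subset G) (cardU : #|U| = q).
Hypothesis cardG : #|G| = (q * (q ^ 2 - 1))%N.
Hypotheses (psi_lin : psi \is a linear_char) (psi_neq1 : psi != 1).
Hypothesis conjU :
  {in U^# &, forall u v, #|[set y in G | (u ^ y)%g == v]| = q}.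

Local Notation Q := (q%:R : algC).
Local Notation Gam := ('Ind[G] psi).

Lemma Q_neq0 : Q != 0. Proof. by rewrite pnatr_eq0 -lt0n ltnW. Qed.

Lemma cardGQ : #|G|%:R = Q * (Q ^+ 2 - 1).
Proof. by rewrite cardG natrM natrB ?natrX // expn_gt0 ltnW. Qed.

Lemma card_index (H : {group gT}) : H \subset G -> #|G : H|%:R = Q * (Q ^+ 2 - 1) / #|H|%:R.
Proof.
move=> sHG; rewrite -cardGQ -(Lagrange sHG) natrM mulrC mulKf //.
by rewrite pnatr_eq0 -lt0n cardG_gt0.
Qed.

Lemma Gam1 : Gam 1%g = Q ^+ 2 - 1.
Proof.
rewrite cfInd1 // lin_char1 // mulr1 card_index // cardU.
by rewrite mulrC mulKf ?Q_neq0.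
Qed.

(** By [conjU] the value is the sum of psi over the nontrivial elements of U, and psi sums to 0 over
    U. *)
Lemma GamU u : u \in U^# -> Gam u = -1.
Proof.
move=> Uu; have [ntu Uu'] := setD1P Uu.
have psi0 : \sum_(v in U) psi v = 0.
  have := cfdot_lin psi_lin (cfun1_lin_char U).
  rewrite (negPf psi_neq1) cfdotE => /eqP; rewrite mulf_eq0 invr_eq0.
  rewrite cardU (negPf Q_neq0) /= => /eqP {2}<-.
  by apply: eq_bigr => v Uv; rewrite cfun1E Uv rmorph1 mulr1.
rewrite cfInd_count // (bigD1 1%g) //=.
rewrite (_ : #|[set y in G | (u ^ y)%g == 1%g]| = 0%N) ?mul0r ?add0r; last first.
  apply: eq_card0 => y; by rewrite !inE conjg_eq1 (negPf ntu) andbF.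
rewrite (eq_bigr (fun v => Q * psi v)) => [|v /andP[Uv ntv]]; last first.
  by rewrite conjU // !inE ntv.
rewrite -mulr_sumr cardU mulKf ?Q_neq0 //.
by move: psi0; rewrite (bigD1 1%g) //= lin_char1 // addrC => /eqP; rewrite addr_eq0 => /eqP.
Qed.

(** The restriction of [Gam] to U is Q times the regular character minus 1, which contains psi
    exactly Q times. *)
Lemma Gam_norm : '[Gam] = Q.
Proof.
rewrite -cfdot_Res_l.
have -> : 'Res[U] Gam = Q *: cfReg U - 1.
  apply/cfun_inP=> u Uu; rewrite cfResE // cfunE cfZRegE cfunE cardU cfun1E Uu.
  have [->|ntu] := eqVneq u 1%g; first by rewrite Gam1 expr2.
  by rewrite GamU ?inE ?ntu // mulr0 sub0r.
rewrite cfdotBl cfdotZl cfdot_Reg cfdot_lin ?cfun1_lin_char //.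
by rewrite lin_char1 // rmorph1 mulr1 eq_sym (negPf psi_neq1) subr0.
Qed.

Lemma Gam_cfdot1 : '[Gam, 1] = 0.
Proof.
by rewrite -Frobenius_reciprocity cfRes_cfun1 // cfdot_lin ?cfun1_lin_char // (negPf psi_neq1).
Qed.

(* e is -1 for the split torus, of order q - 1, and 1 for the nonsplit one. *)
Section Torus.
Variables (T : {group gT}) (e : algC).
Hypotheses (sTG : T \subset G) (e2 : e ^+ 2 = 1) (cardT : #|T|%:R = Q + e).
Hypotheses (oddT : odd #|T|) (co_TU : coprime #|T| q).
Hypothesis conjT : {in T^# &, forall t t',
  #|[set y in G | (t ^ y)%g == t']| = (#|T| * ((t' == t) + (t' == t^-1%g)))%N}.

Lemma Qe_neq0 : Q + e != 0.
Proof. by rewrite -cardT pnatr_eq0 -lt0n cardG_gt0. Qed.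

Lemma indexT : #|G : T|%:R = Q * (Q - e).
Proof.
rewrite card_index // cardT; apply: (canLR (mulfK Qe_neq0)).
ring: e2.
Qed.

Lemma Gam_torus t : t \in T^# -> Gam t = 0.
Proof.
case/setD1P=> ntt Tt; apply: cfInd_coprime_eq0 => //.
by apply: coprime_dvdl (order_dvdG Tt) _; rewrite cardU.
Qed.

(** The only conjugates of t inside T are t and its inverse, which are distinct because |T| is
    odd. *)
Lemma torus_val (la : 'CF(T)) t :
  la \is a linear_char -> t \in T^# -> 'Ind[G] la t = la t + (la t)^*.
Proof.
move=> lin_la T1t; have [ntt Tt] := setD1P T1t.
rewrite cfInd_count // (bigD1 1%g) //=.
rewrite (_ : #|[set y in G | (t ^ y)%g == 1%g]| = 0%N) ?mul0r ?add0r; last first.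
  apply: eq_card0 => y; by rewrite !inE conjg_eq1 (negPf ntt) andbF.
have ttV : t != t^-1%g.
  apply: contra ntt => /eqP tV; rewrite -order_eq1.
  have : (#[t] %| 2)%N by rewrite order_dvdn expgS expg1 {2}tV mulgV.
  have : odd #[t] by apply: dvdn_odd (order_dvdG Tt) oddT.
  by move=> odd_t /(dvdn_leq (isT : (0 < 2)%N)); case: #[t] odd_t => [|[|[|]]].
rewrite (eq_bigr (fun t' => #|T|%:R * (((t' == t)%:R + (t' == t^-1%g)%:R) * la t')))
    => [|t' /andP[Tt' ntt']]; last first.
  have T1t' : t' \in T^# by rewrite !inE ntt'.
  by rewrite (conjT T1t T1t') natrM natrD mulrA.
rewrite -mulr_sumr mulKf ?cardT ?Qe_neq0 //.
have Tt1 : t^-1%g \in T by rewrite groupV.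
have ntt1 : t^-1%g != 1%g by rewrite invg_eq1.
have tVt : (t^-1%g == t) = false by rewrite eq_sym (negPf ttV).
rewrite (bigD1 t) ?Tt //= (bigD1 t^-1%g) /= ?Tt1 ?ntt1 ?tVt //.
rewrite big1 => [|t' /andP[/andP[_ /negPf->] /negPf->]]; last by rewrite addr0 mul0r.
rewrite !eqxx ?(negPf ttV) ?tVt.
by rewrite !(addr0, add0r, mul1r) lin_charV_conj.
Qed.

Lemma torus_dot (la mu : 'CF(T)) :
    la \is a linear_char -> mu \is a linear_char ->
  '['Ind[G] la, 'Ind[G] mu] =
    (Q * (Q - e) - 2) / (Q + e) + (la == mu)%:R + ((la^*)%CF == mu)%:R.
Proof.
move=> lin_la lin_mu; rewrite -cfdot_Res_l.
(* Away from 1 this is [torus_val]; the multiple of the regular character corrects the value at 1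
   from 2 to the index Q (Q - e). *)
have -> : 'Res[T] ('Ind[G] la) =
    ((Q * (Q - e) - 2) / (Q + e)) *: cfReg T + la + (la^*)%CF.
  apply/cfun_inP=> t Tt; rewrite cfResE // 2!cfunE cfZRegE cfConjCE cardT.
  have [->|ntt] := eqVneq t 1%g; last by rewrite torus_val ?inE ?ntt // mulr0 add0r.
  rewrite cfInd1 // lin_char1 // indexT mulr1 divfK ?Qe_neq0 // rmorph1; ring.
rewrite !cfdotDl cfdotZl cfdot_Reg !cfdot_lin ?cfConjC_lin_char //.
by rewrite lin_char1 // rmorph1 mulr1.
Qed.

Lemma Gam_torus_dot (la : 'CF(T)) :
  la \is a linear_char -> '[Gam, 'Ind[G] la] = Q - e.
Proof.
move=> lin_la; rewrite cfdot_Ind_vanish //; last exact: Gam_torus.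
rewrite Gam1 lin_char1 // rmorph1 mulr1 cardT mulrC.
by apply: (canLR (mulfK Qe_neq0)); ring: e2.
Qed.

Lemma torus_Gam_dot (la : 'CF(T)) :
  la \is a linear_char -> '['Ind[G] la, Gam] = Q - e.
Proof.
move=> lin_la; rewrite cfdotC Gam_torus_dot //.
have /orP[] : (e == 1) || (e == -1) by rewrite -sqrf_eq1 e2.
  by move/eqP->; rewrite rmorphB rmorph1 rmorph_nat.
by move/eqP->; rewrite rmorphB rmorphN rmorph1 rmorph_nat.
Qed.

Lemma torus_vchar (la : 'CF(T)) : la \is a linear_char ->
  - e *: ('Ind[G] la - Gam) \in 'Z[irr G].
Proof.
move=> lin_la; have vI : 'Ind[G] la - Gam \in 'Z[irr G].
  by rewrite rpredB // cfInd_vchar // char_vchar // lin_charW.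
have /orP[] : (e == 1) || (e == -1) by rewrite -sqrf_eq1 e2.
  by move/eqP->; rewrite scaleN1r rpredN.
by move/eqP->; rewrite opprK scale1r.
Qed.

(** Since la is not real, Ind la has norm Q - 2 e + 1, and the difference has norm Q - 2 e + 1 - 2
    (Q - e) + Q = 1. The sign - e makes the degree positive. *)
Lemma torus_irr (la : 'CF(T)) : la \is a linear_char -> la != 1 ->
  let chi := - e *: ('Ind[G] la - Gam) in
  [/\ chi \in irr G, chi 1%g = Q - e & '['Res[U] chi, psi] = 1].
Proof.
move=> lin_la la_neq1 chi.
have ereal : (- e)^* = - e.
  have /orP[] : (e == 1) || (e == -1) by rewrite -sqrf_eq1 e2.
    by move/eqP->; rewrite rmorphN rmorph1.
  by move/eqP->; rewrite opprK rmorph1.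
have chi1 : chi 1%g = Q - e.
  rewrite !cfunE cfInd1 // lin_char1 // mulr1 indexT Gam1.
  ring: e2.
split=> //; last first.
  by rewrite cfdot_Res_l cfdotZl cfdotBl torus_Gam_dot // Gam_norm; ring: e2.
apply: vchar_norm1_irr; first exact: torus_vchar.
  rewrite cfdotZl cfdotZr ereal cfdotBl !cfdotBr torus_dot // Gam_norm.
  rewrite torus_Gam_dot // Gam_torus_dot // eqxx (negPf (odd_conj_lin_neq _ _ _)) //.
  rewrite mulr1n mulr0n; field: e2; exact: Qe_neq0.
rewrite chi1; have /orP[] : (e == 1) || (e == -1) by rewrite -sqrf_eq1 e2.
  by move/eqP->; rewrite subr_gt0 ltr1n.
by move/eqP->; rewrite opprK ltr_wpDl ?ler0n ?ltr01.
Qed.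

Section CyclicTorus.
Variable t : gT.
Hypothesis genT : T :=: <[t]>.
Hypothesis psiZ : forall u, exists m : int, psi u = m%:~R.

Lemma Gam_image (L : fieldType) (iota : {rmorphism L -> algC}) g :
  in_image iota (Gam g).
Proof.
rewrite cfIndE //; apply: in_imageM; first exact/in_imageV/in_image_nat.
apply: in_image_sum => y; have [m ->] := psiZ (g ^ y)%g.
by exists m%:~R; rewrite rmorph_int.
Qed.

Lemma cfAut_Gam (u : {rmorphism algC -> algC}) : cfAut u Gam = Gam.
Proof.
rewrite cfAutInd; congr ('Ind _); apply/cfunP=> x; rewrite cfunE.
by have [m ->] := psiZ x; rewrite rmorph_int.
Qed.

(** Off the conjugates of T the induced character is 0, at 1 it is an integer, and at a conjugate of
    a nontrivial t^i it is la(t)^i + la(t)^-i. *)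
Lemma torus_image (L : fieldType) (iota : {rmorphism L -> algC}) (la : 'CF(T)) g :
    la \is a linear_char -> in_image iota (la t + (la t)^-1) ->
  in_image iota ('Ind[G] la g).
Proof.
move=> lin_la im_t; have Tt := gen_mem genT.
have [/exists_inP[y Gy Ty] | noT] := boolP [exists y in G, (g ^ y)%g \in T]; last first.
  rewrite cfIndE // big1 ?mulr0 => [|y Gy]; first exact: (in_image_nat _ 0).
  by apply: cfun0; apply: contra noT => Ty; apply/exists_inP; exists y.
rewrite -(cfunJ _ _ Gy); have [->|nt] := eqVneq (g ^ y)%g 1%g.
  by rewrite cfInd1 // lin_char1 // mulr1; apply: in_image_nat.
rewrite torus_val ?inE ?nt //; have /cycleP[i ->] : (g ^ y)%g \in <[t]> by rewrite -genT.
rewrite -lin_charV_conj ?groupX // lin_charV ?groupX // lin_charX //.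
apply: in_image_power_trace => //.
exact: lin_char_neq0.
Qed.

Lemma torus_realisation d z (la : 'CF(T)) n :
    la \is a linear_char -> la t = z -> d.-primitive_root z -> (2 < d)%N ->
    n%:R = Q - e ->
  exists rho : gT -> 'M[Qadjoin (z + z^-1)%R]_n,
    [/\ rho 1%g = 1%:M, {in G &, {morph rho : x y / (x * y)%g >-> x *m y}}
      & exists iota : {rmorphism Qadjoin (z + z^-1)%R -> algC},
        {in G, forall g, iota (\tr (rho g)) = (- e *: ('Ind[G] la - Gam)) g}].
Proof.
move=> lin_la la_t z_prim d_gt2 nQ.
have la_neq1 : la != 1.
  apply: contraTneq d_gt2 => la1; rewrite -leqNgt dvdn_leq // (prim_order_dvd z_prim).
  by rewrite -la_t la1 cfun1E (gen_mem genT) expr1n.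
have [/irrP[i chiE] chi1 chi_psi] := torus_irr lin_la la_neq1.
pose iota : {rmorphism Qadjoin (z + z^-1)%R -> algC} := @Qadjoin_val (z + z^-1).
have im_w : in_image iota (z + z^-1).
  exact: Qadjoin_val_root.
have im_chi g : g \in G -> in_image iota ('chi_i g).
  move=> _; rewrite -chiE !cfunE; apply: in_imageM.
    have /orP[] : (e == 1) || (e == -1) by rewrite -sqrf_eq1 e2.
      by move/eqP->; apply/in_imageN/(in_image_nat _ 1).
    by move/eqP->; rewrite opprK; apply: (in_image_nat _ 1).
  apply: in_imageD; last exact/in_imageN/Gam_image.
  by apply: torus_image => //; rewrite la_t.
have im_psi u : u \in U -> in_image iota (psi u).
  by move=> _; have [m ->] := psiZ u; exists m%:~R; rewrite rmorph_int.
rewrite chiE in chi1 chi_psi *.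
rewrite -nQ in chi1.
have [rho [rho1 rhoM rho_tr]] :=
  irr_realisation sUG psi_lin im_psi chi1 chi_psi im_chi.
by exists rho; split=> //; exists iota.
Qed.

(** A linear character is determined by its value at the generator t, so one representation per d
    serves every la with [la t = zeta d]. The other characters of order d are reached later by
    Galois conjugation. *)
Lemma torus_family (zeta : nat -> algC) m n :
    (forall d, (0 < d)%N -> d.-primitive_root (zeta d)) ->
    #|T| = m -> n%:R = Q - e ->
  let K d : algType rat := Qadjoin (zeta d + (zeta d)^-1)%R in
  exists rho : forall d : {d | d \in divisors_gt2 m}, gT -> 'M[K (val d)]_n,
    (forall d, rho d 1%g = 1%:M
       /\ {in G &, {morph rho d : x y / (x * y)%g >-> x *m y}})
    /\ (forall a : group_alg rat G, (forall d, rep_alg (rho d) a = 0) ->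
         forall d (la : 'CF(T)), (2 < d)%N -> (d %| #|T|)%N ->
           la \is a linear_char -> la t = zeta d ->
         annihilates a ('Ind[G] la - Gam)).
Proof.
move=> zeta_prim oT nQ K; pose I := {d | d \in divisors_gt2 m}.
have [rho rhoP] : exists rho : forall d : I, gT -> 'M[K (val d)]_n, forall d : I,
    [/\ rho d 1%g = 1%:M, {in G &, {morph rho d : x y / (x * y)%g >-> x *m y}}
      & forall a : group_alg rat G, rep_alg (rho d) a = 0 ->
        forall la : 'CF(T), la \is a linear_char -> la t = zeta (val d) ->
          annihilates a ('Ind[G] la - Gam)].
  apply: (fin_all_exists (P := fun (d : I) (rho : gT -> 'M[K (val d)]_n) =>
    [/\ rho 1%g = 1%:M, {in G &, {morph rho : x y / (x * y)%g >-> x *m y}}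
      & forall a : group_alg rat G, rep_alg rho a = 0 ->
        forall la : 'CF(T), la \is a linear_char -> la t = zeta (val d) ->
          annihilates a ('Ind[G] la - Gam)])) => d.
  have := valP d; rewrite inE => /andP[/andP[d_gt2 _] d_dv].
  have zd_prim := zeta_prim _ (ltn_trans (isT : 0 < 2)%N d_gt2).
  have zd1 : zeta (val d) ^+ #|T| = 1.
    by apply/eqP; rewrite -(prim_order_dvd zd_prim) oT.
  have [la lin_la la_t] := lin_char_of_root genT zd1.
  have [rho [rho1 rhoM [iota rho_tr]]] := torus_realisation lin_la la_t zd_prim d_gt2 nQ.
  exists rho; split=> // a rho_a mu lin_mu mu_t.
  have -> : mu = la by apply: (lin_char_gen_inj genT) => //; rewrite la_t.
  have nz_e : - e != 0 by rewrite oppr_eq0 -sqrf_eq0 e2 oner_eq0.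
  rewrite -[_ - _]scale1r -(mulVf nz_e) -scalerA; apply: annihilatesZ.
  exact: rep_alg_annihilates rhoM rho_tr rho_a.
exists rho; split=> [d | a rho_a d la d_gt2 d_dv lin_la la_t]; first by have [] := rhoP d.
have m_gt0 : (0 < m)%N by rewrite -oT cardG_gt0.
have d_le : (d <= m)%N by rewrite -oT dvdn_leq.
have Dd : Ordinal (d_le : (d < m.+1)%N) \in divisors_gt2 m.
  by rewrite inE /= d_gt2 d_le -oT.
have [_ _ ann] := rhoP (Sub (Ordinal (d_le : (d < m.+1)%N)) Dd).
by apply: ann; rewrite ?rho_a.
Qed.

(** The target is the sum of Ind la - Gam over all linear characters la of T. Each nontrivial la of
    order d is Galois conjugate to the one with value [zeta d] at t. *)
Lemma torus_annihilates (zeta : nat -> algC) (a : group_alg rat G) :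
    (forall d, (0 < d)%N -> d.-primitive_root (zeta d)) ->
    (forall d (la : 'CF(T)), (2 < d)%N -> (d %| #|T|)%N -> la \is a linear_char ->
       la t = zeta d -> annihilates a ('Ind[G] la - Gam)) ->
    annihilates a ('Ind[G] (1 : 'CF(T)) - Gam) ->
  annihilates a (cfReg G - #|T|%:R *: Gam).
Proof.
move=> zeta_prim ann_d ann1.
have -> : cfReg G - #|T|%:R *: Gam = \sum_(i : Iirr T) ('Ind[G] 'chi_i - Gam).
  rewrite sumrB sumr_const -scaler_nat (card_Iirr_cyclic genT); congr (_ - _).
  rewrite -(cfInd_reg sTG) cfReg_sum raddf_sum; apply: eq_bigr => i _ /=.
  by rewrite lin_char1 ?(cyclic_lin genT) // scale1r.
apply: annihilates_sum => i; set la := 'chi_i.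
have lin_la : la \is a linear_char := cyclic_lin genT i.
have n_gt0 := cardG_gt0 T.
have [j la_j] := prim_rootP (zeta_prim _ n_gt0) (lin_char_gen_root genT lin_la).
(* This is the multiplicative order of la(t), an odd number, so either 1 or greater than 2. *)
pose d := (#|T| %/ gcdn j #|T|)%N.
have d_prim : d.-primitive_root (la t) by rewrite la_j; exact: exp_prim_root (zeta_prim _ n_gt0) j.
have d_dv : (d %| #|T|)%N.
  by apply/dvdnP; exists (gcdn j #|T|); rewrite mulnC divnK ?dvdn_gcdr.
have d_gt0 := prim_order_gt0 d_prim.
have [d1 | d_neq1] := eqVneq d 1%N.
  suff -> : la = 1 by [].
  apply: (lin_char_gen_inj genT lin_la (cfun1_lin_char T)).
  rewrite cfun1E (gen_mem genT).
  by have := prim_expr_order d_prim; rewrite d1 expr1.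
have d_gt2 : (2 < d)%N.
  have : odd d by apply: dvdn_odd d_dv oddT.
  by case: (d) d_gt0 d_neq1 => [|[|[|]]].
have [k la_k] := prim_rootP (zeta_prim d d_gt0) (prim_expr_order d_prim).
have co_kd : coprime k d by rewrite -(prim_root_exp_coprime _ (zeta_prim d d_gt0)) -la_k.
(* This automorphism raises d-th roots of unity to the power k, so it carries the character with
   value [zeta d] to la; it fixes Gam, whose values are rational. *)
have [u uE] := Qn_aut_exists co_kd.
have zT : zeta d ^+ #|T| = 1.
  by rewrite -(divnK d_dv) mulnC exprM (prim_expr_order (zeta_prim d d_gt0)) expr1n.
have [mu lin_mu mu_t] := lin_char_of_root genT zT.
have -> : 'Ind[G] la - Gam = cfAut u ('Ind[G] mu - Gam).
  rewrite raddfB /= cfAut_Gam cfAutInd; congr ('Ind _ - _).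
  apply: (lin_char_gen_inj genT lin_la); first by rewrite cfAut_lin_char.
  by rewrite la_k cfunE mu_t uE // prim_expr_order // zeta_prim.
exact/annihilates_aut/(ann_d d).
Qed.

End CyclicTorus.
End Torus.

(** * The Steinberg character and the relation between the two tori *)

Section TwoTori.
Variables (T S : {group gT}).
Hypotheses (sTG : T \subset G) (cardT : #|T| = (q - 1)%N).
Hypotheses (sSG : S \subset G) (cardS : #|S| = (q + 1)%N).
Hypotheses (oddT : odd #|T|) (oddS : odd #|S|).
Hypothesis conjT : {in T^# &, forall t t',
  #|[set y in G | (t ^ y)%g == t']| = (#|T| * ((t' == t) + (t' == t^-1%g)))%N}.
Hypothesis conjS : {in S^# &, forall t t',
  #|[set y in G | (t ^ y)%g == t']| = (#|S| * ((t' == t) + (t' == t^-1%g)))%N}.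

Local Notation I := ('Ind[G] (1 : 'CF(T))).
Local Notation J := ('Ind[G] (1 : 'CF(S))).

Fact cardTQ : #|T|%:R = Q + -1.
Proof. by rewrite cardT natrB // ltnW. Qed.

Fact cardSQ : #|S|%:R = Q + 1.
Proof. by rewrite cardS natrD. Qed.

Fact N1_sqr : (-1) ^+ 2 = 1 :> algC. Proof. by rewrite sqrrN expr1n. Qed.

Fact co_Tq : coprime #|T| q.
Proof. by rewrite cardT subn1 coprime_sym coprimenP // ltnW. Qed.

Fact co_Sq : coprime #|S| q.
Proof. by rewrite cardS addn1 coprime_sym coprimenS. Qed.

Fact co_ST : coprime #|S| #|T|.
Proof.
have -> : #|S| = (#|T| + 2)%N by rewrite cardS cardT; move: q_gt1; clear; lia.
by rewrite coprime_sym /coprime gcdnDl -/(coprime _ _) coprimen2.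
Qed.

Let lin1T := cfun1_lin_char T.
Let lin1S := cfun1_lin_char S.

(** The trivial character equals its conjugate, so both terms of [torus_dot] count and I has norm Q
    + 4. The norm of chi is then (Q + 4) + Q + 1 - 2 (Q + 1) - 2 = 1. *)
Lemma Steinberg_irr :
  let chi := I - Gam - 1 in
  [/\ chi \in irr G, chi 1%g = Q & '['Res[U] chi, psi] = 1].
Proof.
move=> chi; have chi1 : chi 1%g = Q.
  rewrite !cfunE cfInd1 // lin_char1 // (indexT sTG N1_sqr cardTQ) Gam1 cfun11.
  ring.
have Gam1C : '[1, Gam] = 0 by rewrite cfdotC Gam_cfdot1 rmorph0.
have I1 : '[I, 1] = 1 by rewrite -Frobenius_reciprocity cfRes_cfun1 // cfnorm1.
have I1C : '[1, I] = 1 by rewrite cfdotC I1 rmorph1.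
split=> //; last first.
  rewrite cfdot_Res_l !cfdotBl (torus_Gam_dot sTG N1_sqr cardTQ) ?co_Tq //.
  by rewrite Gam_norm Gam1C; ring.
apply: vchar_norm1_irr.
- rewrite !rpredB ?cfInd_vchar ?char_vchar ?lin_charW //; exact: rpred1.
- rewrite !(cfdotBl, cfdotBr) (torus_Gam_dot sTG N1_sqr cardTQ) ?co_Tq //.
  rewrite (Gam_torus_dot sTG N1_sqr cardTQ) ?co_Tq //.
  rewrite (torus_dot sTG N1_sqr cardTQ oddT conjT) // rmorph1 eqxx.
  rewrite Gam_norm Gam1C I1 I1C Gam_cfdot1 cfnorm1.
  rewrite mulr1n; field; exact: (Qe_neq0 cardTQ).
by rewrite chi1 ltr0n ltnW.
Qed.

(* The difference of the two sides has norm 0. *)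
Lemma permutation_char_sum : I + J = 2 *: Gam + 2 *: 1.
Proof.
have Gam1C : '[1, Gam] = 0 by rewrite cfdotC Gam_cfdot1 rmorph0.
have I1 : '[I, 1] = 1 by rewrite -Frobenius_reciprocity cfRes_cfun1 // cfnorm1.
have I1C : '[1, I] = 1 by rewrite cfdotC I1 rmorph1.
have J1 : '[J, 1] = 1 by rewrite -Frobenius_reciprocity cfRes_cfun1 // cfnorm1.
have J1C : '[1, J] = 1 by rewrite cfdotC J1 rmorph1.
(* As |S| and |T| are coprime, I vanishes on S outside 1, and the product is I(1) / |S|. *)
have IJ : '[I, J] = Q.
  rewrite cfdot_Ind_vanish // => [|s /setD1P[nts Ss]].
    rewrite cfInd1 // !lin_char1 // (indexT sTG N1_sqr cardTQ) cardSQ rmorph1.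
    by field; exact: (Qe_neq0 cardSQ).
  by apply: cfInd_coprime_eq0 => //; apply: coprime_dvdl (order_dvdG Ss) co_ST.
have IJC : '[J, I] = Q by rewrite cfdotC IJ rmorph_nat.
have conj1 (H : {group gT}) : (1^*)%CF = 1 :> 'CF(H) by rewrite rmorph1.
apply/eqP; rewrite -subr_eq0 -cfnorm_eq0.
have c2 : (2 : algC)^* = 2 by rewrite rmorph_nat.
rewrite !(cfdotBl, cfdotBr, cfdotDl, cfdotDr, cfdotZl, cfdotZr) c2.
rewrite (torus_Gam_dot sTG N1_sqr cardTQ) ?co_Tq //.
rewrite (Gam_torus_dot sTG N1_sqr cardTQ) ?co_Tq //.
rewrite (torus_dot sTG N1_sqr cardTQ oddT conjT) // conj1 eqxx.
rewrite (torus_Gam_dot sSG (expr1n _ _) cardSQ) ?co_Sq //.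
rewrite (Gam_torus_dot sSG (expr1n _ _) cardSQ) ?co_Sq //.
rewrite (torus_dot sSG (expr1n _ _) cardSQ oddS conjS) // conj1 eqxx.
rewrite Gam_norm Gam1C I1 I1C J1 J1C IJ IJC Gam_cfdot1 cfnorm1 mulr1n.
apply/eqP; field.
by rewrite (Qe_neq0 cardTQ) (Qe_neq0 cardSQ).
Qed.
Hypothesis psiZ : forall u, exists m : int, psi u = m%:~R.

Lemma Steinberg_realisation : exists rho : gT -> 'M[rat]_q,
  [/\ rho 1%g = 1%:M, {in G &, {morph rho : x y / (x * y)%g >-> x *m y}}
    & {in G, forall g, ratr (\tr (rho g)) = (I - Gam - 1) g}].
Proof.
pose iota : {rmorphism rat -> algC} := ratr.
have [/irrP[i chiE] chi1 chi_psi] := Steinberg_irr.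
have im_chi g : g \in G -> in_image iota ('chi_i g).
  move=> Gg; rewrite -chiE !cfunE cfun1E Gg; apply: in_imageD.
    apply: in_imageD; last exact/in_imageN/Gam_image.
    rewrite cfIndE //; apply: in_imageM; first exact/in_imageV/in_image_nat.
    by apply: in_image_sum => y; rewrite cfun1E; apply: in_image_nat.
  exact/in_imageN/(in_image_nat _ 1).
have im_psi u : u \in U -> in_image iota (psi u).
  by move=> _; have [m ->] := psiZ u; exists m%:~R; rewrite rmorph_int.
rewrite chiE in chi1 chi_psi *.
have [rho [rho1 rhoM rho_tr]] :=
  irr_realisation sUG psi_lin im_psi chi1 chi_psi im_chi.
by exists rho.
Qed.

Variables (t s : gT).
Hypotheses (genT : T :=: <[t]>) (genS : S :=: <[s]>).

Lemma annihilates_eq0 (zeta : nat -> algC) (a : group_alg rat G) :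
    (forall d, (0 < d)%N -> d.-primitive_root (zeta d)) ->
    (forall d (la : 'CF(T)), (2 < d)%N -> (d %| #|T|)%N -> la \is a linear_char ->
       la t = zeta d -> annihilates a ('Ind[G] la - Gam)) ->
    (forall d (la : 'CF(S)), (2 < d)%N -> (d %| #|S|)%N -> la \is a linear_char ->
       la s = zeta d -> annihilates a ('Ind[G] la - Gam)) ->
    annihilates a 1 -> annihilates a (I - Gam - 1) ->
  a = 0.
Proof.
move=> zeta_prim annT annS ann1 annSt.
have annI : annihilates a (I - Gam).
  by rewrite -[I - Gam](subrK 1); apply: annihilatesD.
(* The trivial character of S has no component of its own in the product; [permutation_char_sum]
   expresses J - Gam through 1 and I - Gam. *)
have annJ : annihilates a (J - Gam).
  have -> : J - Gam = 2 *: 1 + (-1) *: (I - Gam).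
    rewrite (_ : J = 2 *: Gam + 2 *: 1 - I); last first.
      by rewrite -permutation_char_sum addrC addKr.
    by apply/cfunP=> g; rewrite !cfunE; ring.
  by apply: annihilatesD; apply: annihilatesZ.
have regT := torus_annihilates sTG oddT genT psiZ zeta_prim annT annI.
have regS := torus_annihilates sSG oddS genS psiZ zeta_prim annS annJ.
apply: annihilates_reg.
(* These coefficients sum to 1 and eliminate Gam, which occurs with multiplicities Q - 1 and Q +
   1. *)
have -> : cfReg G = ((Q + 1) / 2) *: (cfReg G - #|T|%:R *: Gam)
    + ((1 - Q) / 2) *: (cfReg G - #|S|%:R *: Gam).
  by rewrite cardTQ cardSQ; apply/cfunP=> g; rewrite !cfunE; field.
by apply: annihilatesD; apply: annihilatesZ.
Qed.

End TwoTori.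
End GelfandGraev.

(** * The degree of Q(zeta + 1/zeta) *)

Lemma rmorph_horner_rat (u : {rmorphism algC -> algC}) (f : {poly rat}) z :
  u (map_poly ratr f).[z] = (map_poly ratr f).[u z].
Proof. by rewrite -horner_map -map_poly_comp (eq_map_poly (fmorph_rat u)). Qed.

Lemma conj_prim_root d (z : algC) : d.-primitive_root z -> z^* = z^-1.
Proof.
move=> z_prim; apply/esym/mulr1_eq.
have z1 : `|z| = 1.
  apply/eqP; rewrite -(@pexpr_eq1 _ _ d) ?(prim_order_gt0 z_prim) //.
  by rewrite -normrX (prim_expr_order z_prim) normr1.
by rewrite -normCK z1 expr1n.
Qed.

(* The powers of w = z + 1/z and their multiples by z are independent because w
   is real and z is not. *)
Lemma deg_trace_root d (z : algC) : (2 < d)%N -> d.-primitive_root z ->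
  (2 * (size (s2val (minCpolyP (z + z^-1)%R))).-1 <= totient d)%N.
Proof.
move=> d_gt2 z_prim; set w := z + z^-1; set m := totient d.
case: (minCpolyP w) => p [Dp p_mon] p_min /=.
set r := (size p).-1; have zC := conj_prim_root z_prim.
have nz_z : z != 0.
  by have := oner_neq0 algC; rewrite -(prim_expr_order z_prim) expf_eq0 (prim_order_gt0 z_prim).
(* Values at z are reduced modulo the minimal polynomial of z, which has degree totient d. *)
have coords (P : {poly rat}) :
    exists x : 'rV[rat]_m, (map_poly ratr P).[z] = \sum_k ratr (x 0 k) * z ^+ k.
  have [pz [Dpz pz_mon] pz_min] := minCpolyP z.
  have nz_pz := monic_neq0 pz_mon.
  have size_pz : size pz = m.+1.
    by rewrite -(size_map_poly (ratr : {rmorphism rat -> algC})) -Dpz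
      (minCpoly_cyclotomic z_prim) size_cyclotomic.
  exists (poly_rV (P %% pz)); rewrite {1}(divp_eq P pz) rmorphD rmorphM hornerD hornerM /=.
  have /rootP-> : root (map_poly ratr pz) z by rewrite pz_min dvdpp.
  rewrite mulr0 add0r (@horner_coef_wide _ m) => [|].
    by apply: eq_bigr => k _; rewrite coef_map mxE.
  by rewrite size_map_poly -ltnS -size_pz ltn_modp.
(* The inverse of z is z^(d-1), so w is a polynomial in z. *)
have wz : w = (map_poly ratr ('X + 'X^(d.-1))).[z].
  rewrite rmorphD /= map_polyX map_polyXn !hornerE; congr (_ + _).
  apply: mulr1_eq; rewrite -exprS prednK ?(prim_order_gt0 z_prim) //.
  exact: prim_expr_order.
have [L LE] : exists L : 'M[rat]_(r, m), forall i : 'I_r, w ^+ i = \sum_k ratr (L i k) * z ^+ k.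
  have /fin_all_exists[x xE] (i : 'I_r) := coords (('X + 'X^(d.-1)) ^+ i).
  exists (\matrix_i x i) => i; rewrite wz -horner_exp -rmorphXn xE.
  by apply: eq_bigr => k _; rewrite mxE.
have [M ME] : exists M : 'M[rat]_(r, m), forall i : 'I_r, z * w ^+ i = \sum_k ratr (M i k) * z ^+ k.
  have /fin_all_exists[x xE] (i : 'I_r) := coords ('X * ('X + 'X^(d.-1)) ^+ i).
  exists (\matrix_i x i) => i.
  have -> : z * w ^+ i = (map_poly ratr ('X * ('X + 'X^(d.-1)) ^+ i)).[z].
    by rewrite rmorphM hornerM /= map_polyX hornerX rmorphXn horner_exp -wz.
  by rewrite xE; apply: eq_bigr => k _; rewrite mxE.
rewrite mul2n -addnn.
suff: row_free (col_mx L M) by move/eqP=> <-; exact: rank_leq_col.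
apply: inj_row_free => v; rewrite -[v]hsubmxK mul_row_col.
set f := lsubmx v; set g := rsubmx v => fg0.
pose ev (h : 'rV[rat]_r) := (map_poly ratr (rVpoly h)).[w].
have evE h : ev h = \sum_i ratr (h 0 i) * w ^+ i.
  rewrite /ev (@horner_coef_wide _ r) ?size_map_poly ?size_poly //.
  by apply: eq_bigr => i _; rewrite coef_map coef_rVpoly_ord.
have ev_sum (h : 'rV_r) (N : 'M[rat]_(r, m)) (beta : 'I_r -> algC) :
    (forall i, beta i = \sum_k ratr (N i k) * z ^+ k) ->
  \sum_i ratr (h 0 i) * beta i = \sum_k ratr ((h *m N) 0 k) * z ^+ k.
  move=> betaE; under eq_bigr => i _ do rewrite betaE mulr_sumr.
  rewrite exchange_big; apply: eq_bigr => k _ /=.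
  rewrite mxE rmorph_sum mulr_suml; apply: eq_bigr => i _.
  by rewrite rmorphM mulrA.
have evfg : ev f + z * ev g = 0.
  rewrite !evE mulr_sumr; under [X in _ + X]eq_bigr => i _ do rewrite mulrCA.
  rewrite (ev_sum f L _ LE) (ev_sum g M _ ME) -big_split /= big1 // => k _.
  by have := congr1 (fun N : 'rV_m => ratr (N 0 k) * z ^+ k) fg0;
    rewrite mxE rmorphD mulrDl [in RHS]mxE rmorph0 mul0r.
have wC : w^* = w by rewrite rmorphD fmorphV /= zC invrK addrC.
have evC h : (ev h)^* = ev h by rewrite rmorph_horner_rat /= wC.
(* Subtracting the complex conjugate of the relation leaves (z - 1/z) ev g = 0, and z differs from
   1/z because d > 2. *)
have evg : ev g = 0.
  have: (z - z^-1) * ev g = 0.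
    transitivity ((ev f + z * ev g) - (ev f + z * ev g)^*).
      by rewrite rmorphD rmorphM /= !evC zC; ring.
    by rewrite evfg rmorph0 subrr.
  move/eqP; rewrite mulf_eq0 subr_eq0 => /orP[/eqP zV|/eqP//].
  have : (d %| 2)%N by rewrite (prim_order_dvd z_prim) expr2 {2}zV mulfV.
  by move/(dvdn_leq (isT : (0 < 2)%N)); rewrite leqNgt d_gt2.
(* h encodes a polynomial of degree less than r, the degree of the minimal polynomial of w. *)
have ev_inj h : ev h = 0 -> h = 0.
  move=> /rootP; rewrite p_min => ph; apply: (can_inj rVpolyK).
  rewrite linear0; apply/eqP; apply: contraTT ph => nz_h.
  rewrite gtNdvdp // (leq_ltn_trans (size_poly _ _)) // /r prednK //.
  by rewrite size_poly_gt0 monic_neq0.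
have g0 : g = 0 by apply: ev_inj.
have f0 : f = 0 by apply: ev_inj; move: evfg; rewrite evg mulr0 addr0.
by rewrite f0 g0 row_mx0.
Qed.

(** * Unipotent elements and tori of SL_2(q), q even *)

Section MatrixEntries.
Variable F : finFieldType.
Implicit Types (g h u : {'GL_2[F]}).

Definition entry (i j : 'I_2) g : F := GLval g i j.

Local Notation a := (entry 0 0).
Local Notation b := (entry 0 1).
Local Notation c := (entry 1 0).
Local Notation d := (entry 1 1).

Lemma det_2x2 (A : 'M[F]_2) : \det A = A 0 0 * A 1 1 - A 0 1 * A 1 0.
Proof.
rewrite (expand_det_row _ 0) !big_ord_recl big_ord0 /cofactor !det_mx11 !mxE /=.
rewrite expr0 expr1 mul1r addr0 mulN1r mulrN.
by congr (A _ _ * A _ _ - A _ _ * A _ _); apply: val_inj.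
Qed.

Lemma entryM i j g h :
  entry i j (g * h)%g = entry i 0 g * entry 0 j h + entry i 1 g * entry 1 j h.
Proof.
rewrite /entry GL_MxE mxE !big_ord_recl big_ord0 addr0.
by congr (_ + GLval g _ _ * GLval h _ _); apply: val_inj.
Qed.

Lemma entry1 i j : entry i j 1%g = (i == j)%:R.
Proof. by rewrite /entry GL_1E mxE. Qed.

Lemma entry_inj g h :
  a g = a h -> b g = b h -> c g = c h -> d g = d h -> g = h.
Proof.
move=> ea eb ec ed; apply/val_inj/matrixP=> i j.
have I2 (k : 'I_2) : k = 0 \/ k = 1.
  by case: k => [[|[|//]] k2]; [left | right]; apply: val_inj.
by have [-> | ->] := I2 i; have [-> | ->] := I2 j.
Qed.

Lemma mem_SL2 g : (g \in SL2 F) = (a g * d g - b g * c g == 1).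
Proof. by rewrite inE det_2x2. Qed.

Lemma SL2_entry (x y z t : F) : x * t - y * z = 1 ->
  {g | g \in SL2 F & [/\ a g = x, b g = y, c g = z & d g = t]}.
Proof.
move=> D1; pose A : 'M[F]_2 := \matrix_(i, j)
  if i == 0 then if j == 0 then x else y else if j == 0 then z else t.
have detA : \det A = 1 by rewrite det_2x2 !mxE.
have uA : A \is a GRing.unit by rewrite -[_ \is a _]/(A \in unitmx) unitmxE detA unitr1.
exists (FinRing.unit _ uA : {'GL_2[F]}); first by rewrite inE; apply/eqP.
by rewrite /entry !mxE.
Qed.

(** The fibres of the determinant on GL_2 are the translates of SL_2 by diag(x, 1), so |SL_2| is
    |GL_2| / (q - 1). *)
Lemma card_SL2 : #|SL2 F| = (#|F| * (#|F| ^ 2 - 1))%N.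
Proof.
have SLfiber (x : F) : x != 0 -> #|[set g : {'GL_2[F]} | \det (GLval g) == x]| = #|SL2 F|.
  move=> nz_x; pose A : 'M[F]_2 := \matrix_(i, j)
    if i == 0 then if j == 0 then x else 0 else (j != 0)%:R.
  have detA : \det A = x by rewrite det_2x2 !mxE /= mul0r subr0 mulr1.
  have uA : A \is a GRing.unit.
    by rewrite -[_ \is a _]/(A \in unitmx) unitmxE detA unitfE.
  pose h : {'GL_2[F]} := FinRing.unit _ uA.
  rewrite -(card_imset (mem (SL2 F)) (mulgI h)); apply: eq_card => g.
  have dethV : \det (GLval (h^-1 * g)%g) = x^-1 * \det (GLval g).
    by rewrite GL_MxE det_mulmx GL_VxE det_inv detA.
  apply/idP/imsetP => [|[k]]; rewrite !inE.
    move=> /eqP detg; exists (h^-1 * g)%g; last by rewrite mulKVg.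
    by rewrite inE dethV detg mulVf.
  by move=> /eqP detk ->; rewrite GL_MxE det_mulmx detk mulr1 detA.
have: #|'GL_2[F]| = (#|F|.-1 * #|SL2 F|)%N.
  rewrite cardsT -[LHS]sum1_card.
  rewrite (partition_big (fun g : {'GL_2[F]} => \det (GLval g)) (predC1 0)) /=; last first.
    move=> g _. exact: (GL_det g).
  rewrite (eq_bigr (fun=> #|SL2 F|)) => [|x nz_x].
    by rewrite sum_nat_const cardC1.
  by rewrite -(SLfiber x nz_x) -sum1_card; apply: eq_bigl => g; rewrite inE.
rewrite card_GL_2 => eqGL; apply/eqP.
have F_gt1 : (1 < #|F|)%N := finRing_gt1 F.
have F1_gt0 : (0 < #|F|.-1)%N by lia.
rewrite -(eqn_pmul2l F1_gt0) -eqGL.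
by apply/eqP; nia.
Qed.
End MatrixEntries.

(** The conjugating elements form the right coset of the centraliser of t by x. *)
Lemma card_conj_eq (gT : finGroupType) (G : {group gT}) t x : x \in G ->
  #|[set y in G | (t ^ y)%g == (t ^ x)%g]| = #|'C_G[t]|.
Proof.
move=> Gx; rewrite -(card_imset (mem 'C_G[t]) (mulIg x)); apply: eq_card => y.
apply/setIdP/imsetP => [[Gy /eqP tyx]|[z /subcent1P[Gz tz] ->]].
  exists (y * x^-1)%g; last by rewrite mulgKV.
  apply/subcent1P; split; first by rewrite groupM ?groupV.
  by apply/commgP/conjg_fixP; rewrite conjgM tyx conjgK.
rewrite groupM //; split=> //; apply/eqP; rewrite conjgM; congr (_ ^ _)%g.
by apply/conjg_fixP/commgP.
Qed.

Lemma sqr_eq1_pchar2 (R : idomainType) (x : R) :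
  2 \in [pchar R] -> x ^+ 2 = 1 -> x = 1.
Proof.
move=> p2 x2; apply/eqP; rewrite -subr_eq0 -sqrf_eq0 sqrrB x2 mulr1.
by rewrite expr1n mulr2n (addrr_pchar2 p2) subr0 (addrr_pchar2 p2).
Qed.

(* Reduces identities modulo 2 to identities for ring; w is the doubled term. *)
Lemma eq_pchar2 (R : nzRingType) (w x y : R) :
  2 \in [pchar R] -> x = y + (w + w) -> x = y.
Proof. by move=> p2; rewrite (addrr_pchar2 p2) addr0. Qed.

Section EvenCharacteristic.
Variable F : finFieldType.
Hypothesis pF2 : 2 \in [pchar F].
Local Notation G := (SL2_group F).
Local Notation q := #|F|.
Local Notation a := (@entry F 0 0).
Local Notation b := (@entry F 0 1).
Local Notation c := (@entry F 1 0).
Local Notation d := (@entry F 1 1).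
Implicit Types (x y z : F) (g h t u v : {'GL_2[F]}).

Lemma pchar2_sqrt x : exists y, y ^+ 2 = x.
Proof.
have inj2 : injective (fun y => y ^+ 2).
  exact: (fmorph_inj (pFrobenius_aut pF2)).
by have /codomP[y ->] := injF_onto inj2 x; exists y.
Qed.

(** U is the centraliser of the matrix (1 1; 0 1). In characteristic 2, determinant 1 forces its
    diagonal entries to be 1, so U is the upper unitriangular group. Its nontrivial elements all
    have centraliser U and are conjugate under diagonal matrices. *)
Lemma unipotent_subgroup : exists U : {group {'GL_2[F]}},
  [/\ U \subset G, #|U| = q, abelian U, {in U, forall u, u ^+ 2 = 1}%g
    & {in U^# &, forall u v, #|[set y in G | (u ^ y)%g == v]| = q}].
Proof.
have [u1 Gu1 [a1 b1 c1 d1]] := @SL2_entry F 1 1 0 1 ltac:(ring).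
have memU g : g \in 'C_G[u1] <-> [/\ a g = 1, c g = 0 & d g = 1].
  split=> [/subcent1P[] | [ag cg dg]].
    rewrite mem_SL2 => /eqP detg cug.
    have := congr1 a cug; rewrite !entryM a1 b1 c1.
    rewrite mulr0 addr0 !mul1r mulr1 => /(canRL (addKr _)); rewrite addNr => cg.
    have := congr1 b cug; rewrite !entryM a1 b1 d1.
    rewrite !mul1r !mulr1 addrC => /addIr dg.
    move: detg; rewrite cg mulr0 subr0 dg -expr2 => /(sqr_eq1_pchar2 pF2) ag.
    by rewrite ag.
  apply/subcent1P; split; first by rewrite mem_SL2 ag cg dg mulr0 subr0 mulr1.
  by apply: entry_inj; rewrite !entryM ?a1 ?b1 ?c1 ?d1 ?ag ?cg ?dg; ring.
have eqU u v : u \in 'C_G[u1] -> v \in 'C_G[u1] -> b u = b v -> u = v.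
  move=> /memU[au cu du] /memU[av cv dv] buv.
  by apply: entry_inj; rewrite ?au ?cu ?du ?av ?cv ?dv.
have cardU : #|'C_G[u1]| = q.
  rewrite -(card_in_imset (f := b) eqU); apply: eq_card => x.
  apply/imsetP; have [g Gg [ag bg cg dg]] := @SL2_entry F 1 x 0 1 ltac:(ring).
  by exists g; rewrite ?bg //; apply/memU.
have abelU : abelian 'C_G[u1].
  apply/centsP=> u /[dup] Uu /memU[au cu du] v /[dup] Uv /memU[av cv dv].
  by apply: eqU; [exact: groupM | exact: groupM | rewrite !entryM au av du dv; ring].
exists 'C_G[u1]%G; split=> //; first exact: subsetIl.
  move=> u /[dup] Uu /memU[au cu du]; apply: eqU; rewrite ?groupX //.
  rewrite expgS expg1 entryM au du mul1r mulr1 (addrr_pchar2 pF2).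
  by rewrite /entry GL_1E mxE.
move=> u v /setD1P[ntu /[dup] Uu /memU[au cu du]] /setD1P[ntv /[dup] Uv /memU[av cv dv]].
have nzb w : w \in 'C_G[u1] -> w != 1%g -> b w != 0.
  move=> Uw; apply: contraNneq => bw; apply/eqP/eqU => //.
  by rewrite bw /entry GL_1E mxE.
have nzbu := nzb u Uu ntu; have nzbv := nzb v Uv ntv.
(* Conjugation by diag(z, 1/z) divides the corner entry by z^2, and every element of F is a
   square. *)
have [z z2] := pchar2_sqrt (b u / b v).
have nz_z : z != 0 by rewrite -sqrf_eq0 z2 mulf_neq0 ?invr_eq0.
have buE : b u = z ^+ 2 * b v by rewrite z2 divfK.
have zz : z * z^-1 - 0 * 0 = 1 by rewrite mulfV // mulr0 subr0.
have [t Gt [at_ bt ct dt]] := SL2_entry zz.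
have -> : v = (u ^ t)%g.
  apply: (mulgI t); rewrite -conjgC.
  apply: entry_inj; rewrite !entryM ?at_ ?bt ?ct ?dt ?au ?cu ?du ?av ?cv ?dv; try ring.
  by rewrite buE; field.
rewrite card_conj_eq // -cardU; apply: eq_card => g.
apply/subcent1P/idP => [[Gg cug] | /[dup] Ug]; last first.
  by move/memU=> [ag cg dg]; split;
    [case/subcent1P: Ug | apply: (centsP abelU)].
have := congr1 a cug; rewrite !entryM au cu => /eqP.
rewrite mulr0 addr0 mul1r mulr1 -subr_eq0 addrC addKr mulf_eq0 (negPf nzbu) /=.
move=> /eqP cg; have := congr1 b cug; rewrite !entryM au du mul1r mulr1.
rewrite addrC [a g * _]mulrC => /addIr /(mulfI nzbu) dg.
move: Gg; rewrite mem_SL2 cg mulr0 subr0 dg -expr2 => /eqP/(sqr_eq1_pchar2 pF2) ag.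
by apply/memU; split=> //; rewrite dg.
Qed.
End EvenCharacteristic.

(** * A self-centralising torus generated by a companion matrix *)

Section TorusEvenCharacteristic.
Variable F : finFieldType.
Hypothesis pF2 : 2 \in [pchar F].
Local Notation G := (SL2_group F).
Local Notation a := (@entry F 0 0).
Local Notation b := (@entry F 0 1).
Local Notation c := (@entry F 1 0).
Local Notation d := (@entry F 1 1).
Implicit Types (x y z : F) (g h t u v : {'GL_2[F]}).

Lemma trace_conj g t : a (t ^ g)%g + d (t ^ g)%g = a t + d t.
Proof.
have trE h : a h + d h = \tr (GLval h).
  rewrite /mxtrace !big_ord_recl big_ord0 addr0.
  by congr (_ + GLval h _ _); apply: val_inj.
rewrite !trE conjgE !GL_MxE mxtrace_mulC -mulmxA.
by rewrite -GL_MxE mulgV GL_1E mulmx1.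
Qed.

Variables (Omega : fieldType) (iota : {rmorphism F -> Omega}) (xi : Omega) (c0 : F).
Variable n : nat.
Hypotheses (c0E : iota c0 = xi + xi^-1) (xi_prim : n.-primitive_root xi).
Hypothesis xi_neqV : xi != xi^-1.
(** The form is the determinant of x + y s for the companion matrix s below, and x + y xi is an
    eigenvalue of it; eigenvalues of elements of determinant 1 are thus n-th roots of unity. *)
Hypothesis norm1 : forall x y, x ^+ 2 + c0 * x * y + y ^+ 2 = 1 ->
  (iota x + iota y * xi) ^+ n = 1.

Let pO2 : 2 \in [pchar Omega]. Proof. by rewrite (fmorph_pchar iota). Qed.

Let nz_xi : xi != 0.
Proof.
have := oner_neq0 Omega.
by rewrite -(prim_expr_order xi_prim) expf_eq0 (prim_order_gt0 xi_prim).
Qed.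

(* s is the companion matrix of X^2 + c0 X + 1 = (X - xi) (X - 1/xi), and eps
   sends an element of its centraliser to the eigenvalue on the column (1, xi). *)
Lemma companion_torus : exists s,
  [/\ s \in G, #[s] = n
    & {in <[s]>^# &, forall t t', #|[set y in G | (t ^ y)%g == t']|
                                  = (n * ((t' == t) + (t' == t^-1%g)))%N}].
Proof.
have det_s : 0 * c0 - 1 * 1 = 1.
  by rewrite mul0r mulr1 sub0r (oppr_pchar2 pF2).
have [s Gs [as_ bs cs ds]] := SL2_entry det_s.
have memC g : g \in 'C_G[s] <-> [/\ g \in G, c g = b g & d g = a g + c0 * b g].
  split=> [/subcent1P[Gg cgs] | [Gg cg dg]].
    have := congr1 a cgs; have := congr1 b cgs; rewrite !entryM as_ bs cs ds.
    rewrite !(mul0r, mulr0, mul1r, mulr1, add0r, addr0) => eb ea.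
    by split=> //; rewrite eb mulrC.
  apply/subcent1P; split=> //.
  by apply: entry_inj; rewrite !entryM ?as_ ?bs ?cs ?ds ?cg ?dg; ring.
have detC g : g \in 'C_G[s] -> a g ^+ 2 + c0 * a g * b g + b g ^+ 2 = 1.
  case/memC; rewrite mem_SL2 => /eqP <- -> ->.
  by apply: (eq_pchar2 (w := b g ^+ 2) pF2); ring.
(* [eps] and [eps'] give the two eigenvalues; their product is the determinant and their sum the
   trace. *)
pose eps g := iota (a g) + iota (b g) * xi.
pose eps' g := iota (a g) + iota (b g) * xi^-1.
have epsK g : g \in 'C_G[s] -> eps g * eps' g = 1.
  move=> Cg; rewrite -(rmorph1 iota) -(detC g Cg) /eps /eps'.
  by rewrite !rmorphD !rmorphXn !rmorphM c0E; field.
have epsM g h : g \in 'C_G[s] -> h \in 'C_G[s] -> eps (g * h)%g = eps g * eps h.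
  move=> Cg Ch; have [_ ch dh] := (memC h).1 Ch.
  rewrite /eps !entryM ch dh !(rmorphD, rmorphM) c0E.
  apply: (eq_pchar2 (w := iota (b g) * iota (b h)) pO2).
  by field.
have eps_inj : {in 'C_G[s] &, injective eps}.
  move=> g h Cg Ch eq_eps.
  have eq_eps' : eps' g = eps' h.
    have nz : eps h != 0.
      by apply/eqP=> z; have /eqP := epsK h Ch; rewrite z mul0r eq_sym oner_eq0.
    by apply: (mulfI nz); rewrite -{1}eq_eps !epsK.
  have eq_b : b g = b h.
    apply: (fmorph_inj iota); apply: (mulIf (_ : xi - xi^-1 != 0)).
      by rewrite subr_eq0.
    have epsB g' : eps g' - eps' g' = iota (b g') * (xi - xi^-1).
      by rewrite /eps /eps'; ring.
    by rewrite -!epsB eq_eps eq_eps'.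
  have eq_a : a g = a h.
    by apply: (fmorph_inj iota); move: eq_eps; rewrite /eps eq_b => /addIr.
  have [_ cg dg] := (memC g).1 Cg; have [_ ch dh] := (memC h).1 Ch.
  by apply: entry_inj; rewrite ?cg ?dg ?ch ?dh ?eq_a ?eq_b.
have eps1 : eps 1%g = 1.
  by rewrite /eps !entry1 rmorph1 rmorph0 mul0r addr0.
have n_gt0 := prim_order_gt0 xi_prim.
(* [eps] embeds the centraliser into the n-th roots of unity. *)
have cardC_le : (#|'C_G[s]| <= n)%N.
  rewrite cardE -(size_map eps); apply: max_unity_roots => //.
    apply/allP=> z /mapP[g]; rewrite mem_enum => Cg ->.
    by apply/unity_rootP/norm1/detC.
  rewrite map_inj_in_uniq ?enum_uniq // => g h; rewrite !mem_enum; exact: eps_inj.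
have Cs : s \in 'C_G[s] by apply/subcent1P.
(* As [eps] sends s to xi, the order of s is at least n, so s generates the whole centraliser. *)
have eps_s i : eps (s ^+ i)%g = xi ^+ i.
  elim: i => [|i IHi]; first exact: eps1.
  rewrite [(s ^+ i.+1)%g]expgS (epsM _ _ Cs (groupX i Cs)) IHi exprS; congr (_ * _).
  by rewrite /eps as_ bs rmorph0 rmorph1 add0r mul1r.
have n_le : (n <= #[s])%N.
  apply: dvdn_leq (order_gt0 s) _; rewrite (prim_order_dvd xi_prim) -eps_s [(s ^+ #[s])%g]expg_order.
  by rewrite eps1.
have sC : <[s]> \subset 'C_G[s] by rewrite cycle_subG.
have eqC : <[s]> = 'C_G[s].
  by apply/eqP; rewrite eqEcard sC; apply: leq_trans cardC_le _.
have order_s : #[s] = n.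
  by apply/eqP; rewrite eqn_leq n_le -[#[s]]/#|<[s]>| eqC cardC_le.
exists s; split=> //.
rewrite eqC => t t' /setD1P[ntt Ct] /setD1P[ntt' Ct'].
have [Gt ct dt] := (memC t).1 Ct.
(* Otherwise t would be a scalar of square 1, hence trivial. *)
have nz_bt : b t != 0.
  apply: contraNneq ntt => bt; apply/eqP/entry_inj; rewrite ?entry1 ?ct ?bt //.
    apply: (sqr_eq1_pchar2 pF2); have := detC t Ct; rewrite bt => <-; ring.
  rewrite dt bt; have := detC t Ct; rewrite bt => e.
  by apply: (sqr_eq1_pchar2 pF2); rewrite -e; ring.
(* t = a + b s with b nonzero, so commuting with t amounts to commuting with s. *)
have CtE : 'C_G[t] = 'C_G[s].
  apply/setP=> g; apply/subcent1P/idP => [[Gg cgt]|Cg]; last first.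
    split; first by case/setIP: Cg.
    have Abel : abelian 'C_G[s] by rewrite -eqC cycle_abelian.
    exact: (centsP Abel).
  apply/memC; split=> //.
    have := congr1 a cgt; rewrite !entryM ct => e.
    by apply: (mulfI nz_bt); apply: (addrI (a t * a g)); rewrite e; ring.
  have := congr1 b cgt; rewrite !entryM dt => e.
  by apply: (mulfI nz_bt); apply: (addrI (a t * b g)); rewrite e; ring.
have traceC g : g \in 'C_G[s] -> iota (a g + d g) = eps g + (eps g)^-1.
  move=> Cg; have [_ _ dg] := (memC g).1 Cg.
  by rewrite (mulr1_eq (epsK g Cg)) /eps /eps' dg !(rmorphD, rmorphM) c0E; ring.
(* The coordinate swap has determinant -1 = 1 and inverts t. *)
have [w Gw [aw bw cw dw]] : {g | g \in SL2 F & [/\ a g = 0, b g = 1, c g = 1 & d g = 0]}.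
  by apply: SL2_entry; rewrite mulr0 mulr1 sub0r (oppr_pchar2 pF2).
have tw : (t ^ w)%g = t^-1%g.
  apply: (mulgI w); rewrite -conjgC; apply: (mulIg t); rewrite mulgKV.
  have dett := detC t Ct; apply: entry_inj.
  - rewrite !entryM aw bw cw dw; apply: (eq_pchar2 (w := a t * b t) pF2).
    by rewrite ct; ring.
  - by rewrite !entryM aw bw cw dw dt -[RHS]dett; ring.
  - by rewrite !entryM aw bw cw dw dt ct -[RHS]dett; ring.
  rewrite !entryM aw bw cw dw; apply: (eq_pchar2 (w := d t * b t) pF2).
  by rewrite ct; ring.
have tV_neq : (t^-1%g == t) = false.
  apply: contraNF ntt => /eqP tV; apply/eqP/eps_inj => //.
  rewrite eps1; apply: (sqr_eq1_pchar2 pO2).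
  by rewrite expr2 -epsM // -{2}tV mulgV eps1.
have [/exists_inP[x Gx /eqP tx] | no_conj] := boolP [exists x in G, (t ^ x)%g == t'].
  rewrite -{1}tx card_conj_eq // CtE -eqC -[#|_|]/#[s] order_s.
  have CtV : t^-1%g \in 'C_G[s] by rewrite groupV.
  suff: (t' == t) || (t' == t^-1%g).
    by case/orP=> /eqP->; rewrite eqxx ?tV_neq ?[t == _]eq_sym ?tV_neq muln1.
  have epsV : eps t^-1%g = (eps t)^-1.
    by apply/esym/mulr1_eq; rewrite -epsM // mulgV.
  have nz_eps g : g \in 'C_G[s] -> eps g != 0.
    by move=> Cg; apply/eqP=> z; have /eqP := epsK g Cg; rewrite z mul0r eq_sym oner_eq0.
  have nzt := nz_eps t Ct; have nzt' := nz_eps t' Ct'.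
  (* Conjugation preserves the trace eps + 1/eps, so [eps t'] is [eps t] or its inverse. *)
  have: iota (a t' + d t') = iota (a t + d t) by rewrite -tx trace_conj.
  rewrite !traceC // => eq_tr.
  have: (eps t' - eps t) * (eps t' - (eps t)^-1) = 0.
    have: (eps t' + (eps t')^-1) * eps t' - (eps t + (eps t)^-1) * eps t' = 0.
      by rewrite eq_tr subrr.
    by move=> <-; field; rewrite nzt nzt'.
  move/eqP; rewrite mulf_eq0 !subr_eq0 -epsV => /orP[] /eqP/eps_inj->; rewrite ?eqxx ?orbT //.
rewrite (_ : #|_| = 0%N); last first.
  apply: eq_card0 => y; rewrite inE; apply: contraNF no_conj => /andP[Gy ty].
  by apply/exists_inP; exists y.
have: t' != t.
  by apply: contraNneq no_conj => ->; apply/exists_inP; exists 1%g; rewrite ?conjg1.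
have: t' != t^-1%g.
  by apply: contraNneq no_conj => ->; apply/exists_inP; exists w; rewrite ?tw.
by move=> /negPf-> /negPf->; rewrite muln0.
Qed.

End TorusEvenCharacteristic.

(** * Existence of the split and nonsplit tori *)

Lemma closed_prim_root (K : closedFieldType) n :
  n%:R != 0 :> K -> exists z : K, n.-primitive_root z.
Proof.
move=> nz_n; have n_gt0 : (0 < n)%N by case: n nz_n => //; rewrite eqxx.
have [r Dr] := closed_field_poly_normal ('X^n - 1 : {poly K}).
move: Dr; rewrite lead_coefDl ?size_polyXn ?size_polyN ?size_poly1 // lead_coefXn scale1r => Dr.
have: has n.-primitive_root r.
  apply: has_prim_root => //.
  - by apply/allP=> z rz; rewrite /root_of_unity Dr root_prod_XsubC.
  - by rewrite -separable_prod_XsubC -Dr separable_Xn_sub_1.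
  by rewrite -ltnS -(size_prod_XsubC r id) -Dr size_polyDl size_polyXn // size_polyN size_poly1.
by case/hasP=> z _; exists z.
Qed.

(** Take xi a primitive n-th root of unity in the algebraic closure. Frobenius fixes xi when n = q -
    1 and inverts it when n = q + 1, so xi + 1/xi lies in F and [companion_torus] applies. *)
Lemma inverting_torus (F : finFieldType) k n :
    (0 < k)%N -> #|F| = (2 ^ k)%N -> n = (#|F| - 1)%N \/ n = (#|F| + 1)%N ->
  exists s, [/\ s \in SL2_group F, #[s] = n
    & {in <[s]>^# &, forall t t', #|[set y in SL2_group F | (t ^ y)%g == t']|
                                  = (n * ((t' == t) + (t' == t^-1%g)))%N}].
Proof.
move=> k_gt0 cardF defn; have pF2 : 2 \in [pchar F] by apply: card_finPcharP cardF _.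
have evenF : odd #|F| = false by rewrite cardF oddX; case: k k_gt0 {cardF}.
have F_gt1 : (1 < #|F|)%N := finRing_gt1 F.
have [n1 | n_neq1] := eqVneq n 1%N.
  (* Here q = 2, and the companion matrix for xi = 1 would have order 2. *)
  exists 1%g; rewrite group1 order1 n1; split=> // t t'.
  by rewrite cycle1 !inE andNb.
have odd_n : odd n.
  by case: defn => ->; rewrite ?oddB ?oddD ?evenF //; lia.
have n_gt2 : (2 < n)%N by move: odd_n n_neq1; case: n defn => [|[|[|]]].
have [K [iota _]] := countable_algebraic_closure F.
have pK2 : 2 \in [pchar K] by rewrite (fmorph_pchar iota).
have nz_n : n%:R != 0 :> K by rewrite -(dvdn_pcharf pK2) dvdn2 odd_n.
have [xi xi_prim] := closed_prim_root nz_n.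
have xin := prim_expr_order xi_prim.
have nz_xi : xi != 0.
  by have := oner_neq0 K; rewrite -xin expf_eq0 (prim_order_gt0 xi_prim).
have natq : [pchar K].-nat #|F| by rewrite cardF pnatX pnatE // pK2.
have xiq : xi ^+ #|F| = xi /\ n = (#|F| - 1)%N \/ xi ^+ #|F| = xi^-1 /\ n = (#|F| + 1)%N.
  case: defn => defn; [left | right]; split=> //.
    by rewrite -{1}(subnK (ltnW F_gt1)) -defn addn1 exprS xin mulr1.
  by apply: (mulfI nz_xi); rewrite -exprS -addn1 -defn xin divff.
have iotaq x : iota x ^+ #|F| = iota x by rewrite -rmorphXn expf_card.
(* xi + 1/xi is a root of X^q - X, whose roots are the elements of F. *)
have [c0 c0E] : exists c0, iota c0 = xi + xi^-1.
  have : root (map_poly iota ('X^#|F| - 'X)) (xi + xi^-1).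
    rewrite rmorphB /= map_polyXn map_polyX /root !hornerE subr_eq0.
    rewrite exprDn_pchar // exprVn.
    by case: xiq => [[-> _]|[-> _]]; rewrite ?invrK // addrC.
  rewrite finField_genPoly rmorph_prod /=.
  rewrite (eq_bigr (fun x => 'X - (iota x)%:P)) => [|x _]; last by rewrite map_polyXsubC.
  rewrite -(big_map iota xpredT (fun x => 'X - x%:P)) root_prod_XsubC.
  by case/mapP=> x _ ->; exists x.
apply: (companion_torus pF2 c0E xi_prim) => [|x y xy1].
  apply: contraTneq n_gt2 => xiV; rewrite -leqNgt dvdn_leq // (prim_order_dvd xi_prim).
  by rewrite expr2 {1}xiV mulVf.
have eps1 : (iota x + iota y * xi) * (iota x + iota y * xi^-1) = 1.
  by rewrite -(rmorph1 iota) -xy1 !rmorphD !rmorphXn !rmorphM c0E; field.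
have epsq : (iota x + iota y * xi) ^+ #|F| = iota x + iota y * xi ^+ #|F|.
  by rewrite exprDn_pchar // exprMn !iotaq.
(* In the nonsplit case the q-th power of x + y xi is its conjugate x + y / xi, and the product of
   the two is 1. In the split case the q-th power is x + y xi itself, which is nonzero and can be
   cancelled. *)
case: xiq epsq => [[-> ->]|[-> ->]] epsq; last by rewrite addn1 exprS epsq.
have nz_eps : iota x + iota y * xi != 0.
  by apply/eqP=> z; have /eqP := eps1; rewrite z mul0r eq_sym oner_eq0.
by apply: (mulfI nz_eps); rewrite -exprS mulr1 -addn1 subnK // ltnW.
Qed.

(** * The decomposition *)

Lemma card_subg_of (gT : finGroupType) (G : {group gT}) : #|{: subg_of G}| = #|G|.
Proof. by rewrite card_sub; apply: eq_card. Qed.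

Lemma group_alg_isog (R : comNzRingType) (gT hT : finGroupType)
    (G : {group gT}) (H : {group hT}) : G \isog H ->
  exists g : group_alg R H -> group_alg R G,
    [/\ linear g, monoid_morphism g & bijective g].
Proof.
case/isogP=> f f_inj fG.
have Hf (x : subg_of G) : f (val x) \in H by rewrite -fG mem_morphim ?(valP x).
pose phi (x : subg_of G) : subg_of H := Subg (Hf x).
have phiM : {morph phi : x y / (x * y)%g}.
  by move=> x y; apply: val_inj; apply: (morphM f (valP x) (valP y)).
have phi_inj : injective phi.
  move=> x y /(congr1 val) /= /(injmP f_inj) eq_xy; apply: val_inj.
  by apply: eq_xy; apply: valP.
have phi_bij : bijective phi.
  apply: inj_card_bij => //.
  by rewrite !card_subg_of -fG card_injm.
exists (fun a => [ffun x => a (phi x)]); split.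
- by move=> r a b; apply/ffunP=> x; rewrite !ffunE.
- split=> [|a b]; apply/ffunP=> x.
    rewrite !ffunE -(inj_eq phi_inj); congr (_ == _)%:R.
    by apply: val_inj; rewrite /= morph1.
  rewrite !ffunE (reindex phi) /=; last exact: onW_bij.
  apply: eq_bigr => y _; rewrite !ffunE phiM; congr (_ * b (_ * _)%g).
  by apply: (mulgI (phi y)); rewrite mulgV -phiM mulgV; apply: val_inj; rewrite /= morph1.
have [psi phiK psiK] := phi_bij.
exists (fun a : group_alg R G => [ffun x => a (psi x)] : group_alg R H) => a;
  by apply/ffunP=> x; rewrite !ffunE ?phiK ?psiK.
Qed.

(** Commuting with both elementary unipotents forces a scalar matrix; its square is 1, so it is
    1. *)
Lemma center_SL2 (F : finFieldType) : 2 \in [pchar F] -> 'Z(SL2 F) = 1%g.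
Proof.
move=> pF2; apply/trivgP/subsetP=> z /centerP[Gz cz]; apply/set1gP.
have [u Gu [au bu cu du]] := @SL2_entry F 1 1 0 1 ltac:(ring).
have [v Gv [av bv cv dv]] := @SL2_entry F 1 0 1 1 ltac:(ring).
have eu := cz u Gu; have ev := cz v Gv.
have c0 : entry 1 0 z = 0.
  have := congr1 (entry 0 0) eu; rewrite !entryM au bu cu.
  by rewrite mulr1 mulr0 addr0 !mul1r => /esym/(canRL (addKr _)); rewrite addNr.
have b0 : entry 0 1 z = 0.
  have := congr1 (entry 0 0) ev; rewrite !entryM av bv cv.
  by rewrite !mulr1 mul1r mul0r addr0 => /(canRL (addKr _)); rewrite addNr.
have ad : entry 0 0 z = entry 1 1 z.
  have := congr1 (entry 0 1) eu; rewrite !entryM au bu du b0.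
  by rewrite !(mulr1, mul1r, mulr0, mul0r, addr0, add0r).
have d1 : entry 1 1 z = 1.
  apply: (sqr_eq1_pchar2 pF2); move: Gz; rewrite mem_SL2 ad b0 mul0r subr0 -expr2.
  by move/eqP.
by apply: entry_inj; rewrite !entry1 ?ad ?b0 ?c0 ?d1.
Qed.

Lemma SL2_isog_PSL2 (F : finFieldType) : 2 \in [pchar F] ->
  SL2_group F \isog PSL2 F.
Proof.
move=> pF2; apply: quotient_isog; first exact/normal_norm/center_normal.
by rewrite /= center_SL2 //; apply/trivgP/subsetIl.
Qed.

(** The totients of all divisors of n sum to n, and 1 is the only divisor of an odd n not exceeding
    2. *)
Lemma sum_totient_gt2 n : odd n ->
  (\sum_(d : {d | d \in divisors_gt2 n}) totient (val d) = n - 1)%N.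
Proof.
move=> odd_n; have n_gt0 := odd_gt0 odd_n.
have one_n : (1 < n.+1)%N by [].
transitivity (\sum_(d in divisors_gt2 n) totient d)%N.
  transitivity (\sum_(d in divisors_gt2 n | true) totient d)%N.
    by rewrite big_sub_cond.
  by apply: eq_bigl => d; rewrite andbT.
rewrite -[X in _ = (X - 1)%N](sum_totient_dvd n) [in RHS](bigD1 (Ordinal one_n)) //=.
rewrite (_ : totient 1 = 1%N) // addKn.
apply: eq_bigl => d; rewrite inE -val_eqE /=.
have [d_dv|] := boolP (d %| n)%N; last by rewrite andbF.
have d_odd := dvdn_odd d_dv odd_n; rewrite ?(dvdn_leq n_gt0 d_dv) ?andbT /=.
by case: (nat_of_ord d) d_odd => [|[|[|]]].
Qed.

Lemma embeds_component (zeta : nat -> algC) m n :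
    (forall d, (0 < d)%N -> d.-primitive_root (zeta d)) -> odd m ->
  let K d : algType rat := Qadjoin (zeta d + (zeta d)^-1)%R in
  exists J : finType,
    embeds_in (matrix_prod (fun d : {d | d \in divisors_gt2 m} => K (val d)) n) J
    /\ (2 * #|J| <= n ^ 2 * (m - 1))%N.
Proof.
move=> zeta_prim odd_m K; pose I := {d | d \in divisors_gt2 m}.
pose r (d : I) := (size (s2val (minCpolyP (zeta (val d) + (zeta (val d))^-1)%R))).-1.
exists {d : I & ('I_n * 'I_n * 'I_(r d))%type}.
split; first by apply: embeds_matrix_prod => d; apply: embeds_Qadjoin.
rewrite card_tagged sumnE big_map big_enum /= -(sum_totient_gt2 odd_m) !big_distrr /=.
apply: leq_sum => d _; rewrite !card_prod !card_ord mulnCA -mulnn leq_mul2l.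
have := valP d; rewrite inE => /andP[/andP[d_gt2 _] _].
by rewrite deg_trace_root ?orbT // zeta_prim // ltnW // ltnW.
Qed.

(** With equality in both hypotheses the left side is exactly q^3 - q, so the degree bounds leave no
    slack. *)
Lemma wedderburn_dim_bound q x y : (1 < q)%N ->
    (2 * x <= (q - 1) ^ 2 * (q + 1 - 1))%N ->
    (2 * y <= (q + 1) ^ 2 * (q - 1 - 1))%N ->
  (1 + x + q * q + y <= q * (q ^ 2 - 1))%N.
Proof.
case: q => [|[|p]] // _; rewrite -!mulnn !addnK subn1 subn1 /= => hx hy; nia.
Qed.

Theorem theorem1 (k q : nat) (k_gt0 : (0 < k)%N) (q_eq : q = (2 ^ k)%N)
    (F : finFieldType) (card_F : #|F| = q)
    (zeta : nat -> algC)
    (zeta_prim : forall d : nat, (0 < d)%N -> d.-primitive_root (zeta d)) :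
  let K (d : nat) : algType rat := Qadjoin (zeta d + (zeta d)^-1) in
  let A := divisors_gt2 (q + 1) in
  let B := divisors_gt2 (q - 1) in
  let W : Type :=
    (rat^o
     * matrix_prod (fun d : {d | d \in A} => K (val d)) (q - 1)
     * 'M[rat]_q
     * matrix_prod (fun d : {d | d \in B} => K (val d)) (q + 1))%type in
  (exists f : group_alg rat (SL2_group F) -> W,
     [/\ linear f, monoid_morphism f & bijective f]) /\
  (exists f : group_alg rat (PSL2 F) -> W,
     [/\ linear f, monoid_morphism f & bijective f]).
Proof.
move=> K A B W.
(* The case of PSL_2 follows because the centre of SL_2 is trivial in characteristic 2. *)
suff [f [f_lin f_mon f_bij]] : exists f : group_alg rat (SL2_group F) -> W,
    [/\ linear f, monoid_morphism f & bijective f].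
  split; first by exists f.
  have pF2 : 2 \in [pchar F] by apply: (card_finPcharP (n := k)); rewrite ?card_F.
  have [g [g_lin [g1 gM] g_bij]] := group_alg_isog rat (SL2_isog_PSL2 pF2).
  exists (f \o g); split; last exact: bij_comp.
    by move=> r a b /=; rewrite g_lin f_lin.
  by case: f_mon => f1 fM; split=> [|a b] /=; rewrite ?g1 ?f1 ?gM ?fM.
pose G := SL2_group F; have cF : #|F| = (2 ^ k)%N by rewrite card_F.
have pF2 : 2 \in [pchar F] by apply: card_finPcharP cF _.
have q_gt1 : (1 < q)%N by rewrite q_eq -{1}(expn0 2) ltn_exp2l.
have even_q : ~~ odd q by rewrite q_eq oddX; case: (k) k_gt0.
have cardG : #|G| = (q * (q ^ 2 - 1))%N by rewrite card_SL2 card_F.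
have [U [sUG cardU abelU U2 conjU]] := unipotent_subgroup pF2.
rewrite card_F in cardU conjU.
have [|psi [psi_lin psi_neq1 psiZ]] := sign_lin_char abelU _ U2; first by rewrite cardU.
have [t [Gt order_t conjT]] := inverting_torus k_gt0 cF (or_introl (erefl _)).
have [s [Gs order_s conjS]] := inverting_torus k_gt0 cF (or_intror (erefl _)).
rewrite card_F in order_t order_s conjT conjS.
pose T : {group {'GL_2[F]}} := <[t]>%G; pose S : {group {'GL_2[F]}} := <[s]>%G.
have sTG : T \subset G by rewrite cycle_subG.
have sSG : S \subset G by rewrite cycle_subG.
have cardT : #|T| = (q - 1)%N by [].
have cardS : #|S| = (q + 1)%N by [].
have odd_q1 : odd (q - 1) by rewrite oddB ?(negPf even_q) // ltnW.
have odd_q2 : odd (q + 1) by rewrite oddD (negPf even_q).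
have oddT : odd #|T| by rewrite cardT.
have oddS : odd #|S| by rewrite cardS.
rewrite -cardT in conjT; rewrite -cardS in conjS.
have [St [St1 StM St_tr]] := Steinberg_realisation q_gt1 sUG cardU cardG psi_lin
  psi_neq1 conjU sTG cardT oddT conjT psiZ.
have qA : (q - 1)%:R = q%:R - 1 :> algC by rewrite natrB // ltnW.
have qB : (q + 1)%:R = q%:R - -1 :> algC by rewrite natrD opprK.
(* The nonsplit torus S, with e = 1, gives the components of size q - 1; the split torus T, with e =
   -1, then gives those of size q + 1. *)
have [rhoA [rhoA_mor annA]] := torus_family q_gt1 sUG cardU cardG psi_lin psi_neq1
  conjU sSG (expr1n _ _) (cardSQ cardS) oddS (co_Sq cardS) conjS (erefl : S :=: <[s]>)
  psiZ zeta_prim cardS qA.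
have [rhoB [rhoB_mor annB]] := torus_family q_gt1 sUG cardU cardG psi_lin psi_neq1
  conjU sTG N1_sqr (cardTQ q_gt1 cardT) oddT (co_Tq q_gt1 cardT) conjT (erefl : T :=: <[t]>)
  psiZ zeta_prim cardT qB.
pose fA (a : group_alg rat G) : matrix_prod (fun d : {d | d \in A} => K (val d)) (q - 1) :=
  [ffun d => rep_alg (rhoA d) a].
pose fB (a : group_alg rat G) : matrix_prod (fun d : {d | d \in B} => K (val d)) (q + 1) :=
  [ffun d => rep_alg (rhoB d) a].
pose fSt (a : group_alg rat G) : 'M[rat]_q := rep_alg (K := rat^o) St a.
pose triv (_ : {'GL_2[F]}) : 'M[rat^o]_1 := 1%:M.
have trivM : {in G &, {morph triv : x y / (x * y)%g >-> x *m y}}.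
  by move=> x y _ _; rewrite mulmx1.
pose f0 (a : group_alg rat G) : rat^o := rep_alg triv a 0 0.
pose f a : W := (f0 a, fA a, fSt a, fB a).
have f_lin : linear f.
  move=> r a b; congr (_, _, _, _); first exact: rep_algL.
  - by apply/ffunP=> d; apply/matrixP=> i j; rewrite !ffunE rep_algL !mxE.
  - apply/matrixP=> i j; transitivity (r * fSt a i j + fSt b i j).
      exact: (@rep_algL _ G rat^o q St r a b i j).
    by rewrite [RHS]mxE [in RHS]mxE.
  by apply/ffunP=> d; apply/matrixP=> i j; rewrite !ffunE rep_algL !mxE.
have f_mon : monoid_morphism f.
  split=> [|a b]; congr (_, _, _, _).
  - by rewrite /f0 rep_alg1 // mxE.
  - by apply/ffunP=> d; rewrite !ffunE rep_alg1 //; case: (rhoA_mor d).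
  - exact: (@rep_alg1 _ G rat^o q St St1).
  - by apply/ffunP=> d; rewrite !ffunE rep_alg1 //; case: (rhoB_mor d).
  - by rewrite /f0 rep_algM // mxE big_ord1.
  - by apply/ffunP=> d; rewrite !ffunE rep_algM //; case: (rhoA_mor d).
  - exact: (@rep_algM _ G rat^o q St StM).
  by apply/ffunP=> d; rewrite !ffunE rep_algM //; case: (rhoB_mor d).
pose ratC : {rmorphism rat^o -> algC} := (ratr : {rmorphism rat -> algC}).
have f_inj a : f a = 0 -> a = 0.
  case=> f0a fAa fSta fBa.
  have rhoA0 d : rep_alg (rhoA d) a = 0 by have /ffunP/(_ d) := fAa; rewrite !ffunE.
  have rhoB0 d : rep_alg (rhoB d) a = 0 by have /ffunP/(_ d) := fBa; rewrite !ffunE.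
  apply: (annihilates_eq0 q_gt1 sUG cardU cardG psi_lin psi_neq1 conjU sTG cardT
    sSG cardS oddT oddS conjT conjS psiZ (erefl : T :=: <[t]>) (erefl : S :=: <[s]>)
    zeta_prim (annB a rhoB0) (annA a rhoA0)).
    apply: (@rep_alg_annihilates _ G rat^o _ triv ratC 1 a trivM) => [g Gg|].
      by rewrite mxtrace1 rmorph1 cfun1E Gg.
    by apply/matrixP=> i j; rewrite !ord1 [RHS]mxE; exact: f0a.
  exact: (@rep_alg_annihilates _ G rat^o _ St ratC _ a StM St_tr).
have [JA [embA cardJA]] : exists J : finType,
    embeds_in (matrix_prod (fun d : {d | d \in A} => K (val d)) (q - 1)) J
    /\ (2 * #|J| <= (q - 1) ^ 2 * (q + 1 - 1))%N.
  exact: embeds_component zeta_prim odd_q2.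
have [JB [embB cardJB]] : exists J : finType,
    embeds_in (matrix_prod (fun d : {d | d \in B} => K (val d)) (q + 1)) J
    /\ (2 * #|J| <= (q + 1) ^ 2 * (q - 1 - 1))%N.
  exact: embeds_component zeta_prim odd_q1.
have embW := embeds_pair (embeds_pair (embeds_pair embeds_rat embA) (embeds_matrix q)) embB.
exists f; split=> //.
(* Surjectivity by counting dimensions. *)
refine (@group_alg_inj_bij _ G _ _ f f_lin f_inj embW _).
rewrite !card_sum card_unit card_prod card_ord cardG.
exact: wedderburn_dim_bound.
Qed.
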